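(* Let $H$ be a (fixed) $\ell$-uniform hypergraph with at least $2$ edges. Then, as $k$ tends to infinity, we have $$R_{\mathrm{list}}(H,k)\le (1-\pi(H)+o(1))^{-k\,m(H)}.$$
   Context: $K_n^{(\ell)}$ is the complete $\ell$-uniform hypergraph on $n$ vertices. Given an assignment $L$ of a set $L_e\subseteq\mathbb{N}$ to each edge $e$ of $K_n^{(\ell)}$, an $L$-colouring is a function $c:E(K_n^{(\ell)})\to\mathbb{N}$ with $c(e)\in L_e$ for all $e$. For an $\ell$-uniform hypergraph $H$ and a positive integer $k$, the list Ramsey number $R_{\mathrm{list}}(H,k)$ is the smallest $n$ for which there exists an assignment $L$ of lists with $|L_e|=k$ for every $e\in E(K_n^{(\ell)})$ such that every $L$-colouring of $E(K_n^{(\ell)})$ contains a monochromatic copy of $H$ (a not necessarily induced subhypergraph isomorphic to $H$ all of whose edges have the same colour). Let $\mathrm{ex}(H,n)$ denote the maximum number of edges in an $\ell$-uniform hypergraph on $n$ vertices containing no copy of $H$, and let $\pi(H)=\lim_{n\to\infty}\mathrm{ex}(H,n)/\binom{n}{\ell}$. For $H$ with at least two edges let $$m(H)=\max_{H'\subseteq H,\ e(H')>1}\frac{e(H')-1}{v(H')-\ell},$$ where the maximum is over subhypergraphs $H'$ of $H$ with more than one edge and $e(H'),v(H')$ are the numbers of edges and vertices of $H'$. The $o(1)$ term tends to $0$ as $k\to\infty$ for fixed $H$. *)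

(* Defs.v *)
From HB Require Import structures.
From mathcomp Require Import all_boot all_order all_algebra finmap.
From mathcomp Require Import all_classical all_reals all_analysis.

Set Implicit Arguments.
Unset Strict Implicit.
Unset Printing Implicit Defensive.

Import Order.TTheory GRing.Theory Num.Theory.
Import numFieldNormedType.Exports.

(* A hypergraph is given by its (finite) vertex type [T] and its edge set
   [H : {set {set T}}]; every element of [T] is a vertex, so isolated vertices
   are allowed and [#|T|] is the number of vertices. *)

Definition uniform_hypergraph (l : nat) (T : finType) (H : {set {set T}}) :
    bool :=
  [forall e in H, #|e| == l].

Definition complete_hypergraph (l n : nat) : {set {set 'I_n}} :=
  [set e : {set 'I_n} | #|e| == l].

(* [G] contains a not necessarily induced copy of [H]. All vertices of [H],
   isolated ones included, are embedded. *)
Definition contains_copy (T W : finType) (H : {set {set T}})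
    (G : {set {set W}}) : bool :=
  [exists f : {ffun T -> W},
    injectiveb f && [forall e in H, f @: (e : {set T}) \in G]].

Definition extremal_number (l : nat) (T : finType) (H : {set {set T}})
    (n : nat) : nat :=
  \max_(G : {set {set 'I_n}} | uniform_hypergraph l G && ~~ contains_copy H G)
    #|G|.

Section RealParameters.
Variable R : realType.
Local Open Scope ring_scope.
Local Open Scope classical_set_scope.

Definition turan_density (l : nat) (T : finType) (H : {set {set T}}) : R :=
  limn (fun n : nat => (extremal_number l H n)%:R / 'C(n, l)%:R : R).

(* A subhypergraph is a pair (vertex set, edge set). *)
Definition subhypergraph (T : finType) (H : {set {set T}})
    (H' : {set T} * {set {set T}}) : bool :=
  (H'.2 \subset H) && [forall e in H'.2, (e : {set T}) \subset H'.1].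

(* If [H] is [l]-uniform, two distinct edges span more than [l] vertices, so
   all denominators below are positive. If [H] has at least two edges, the
   range is nonempty and the default value 0 does not affect the maximum. *)
Definition max_density (l : nat) (T : finType) (H : {set {set T}}) : R :=
  \big[Num.max/0]_(H' : {set T} * {set {set T}} |
                    subhypergraph H H' && (1 < #|H'.2|)%N)
    ((#|H'.2|%:R - 1) / (#|H'.1|%:R - l%:R)).

End RealParameters.

Section ListRamsey.
Local Open Scope fset_scope.

(* List assignments and colourings are total functions on vertex sets, of
   which only the values on the edges of the complete hypergraph matter. *)
Definition list_assignment (l n k : nat) (L : {set 'I_n} -> {fset nat}) :
    Prop :=
  forall e, e \in complete_hypergraph l n -> #|` L e| = k.

Definition list_colouring (l n : nat) (L : {set 'I_n} -> {fset nat})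
    (c : {set 'I_n} -> nat) : Prop :=
  forall e, e \in complete_hypergraph l n -> c e \in L e.

Definition monochromatic_copy (l n : nat) (T : finType) (H : {set {set T}})
    (c : {set 'I_n} -> nat) : Prop :=
  exists a : nat,
    contains_copy H [set e in complete_hypergraph l n | c e == a].

Definition list_ramsey_property (l : nat) (T : finType) (H : {set {set T}})
    (k n : nat) : Prop :=
  exists L : {set 'I_n} -> {fset nat},
    list_assignment l k L /\
    forall c : {set 'I_n} -> nat,
      list_colouring l L c -> monochromatic_copy l H c.

Definition is_list_ramsey_number (l : nat) (T : finType) (H : {set {set T}})
    (k n : nat) : Prop :=
  list_ramsey_property l H k n /\
  forall m : nat, list_ramsey_property l H k m -> (n <= m)%N.

End ListRamsey.

(* Main.v *)
Require Import Defs.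
From HB Require Import structures.
From mathcomp Require Import all_boot all_order all_algebra finmap.
From mathcomp Require Import all_classical all_reals all_analysis.
From mathcomp Require Import ring lra fintype finset.
Import Order.TTheory GRing.Theory Num.Theory.
Import numFieldNormedType.Exports.
Set Implicit Arguments.
Unset Strict Implicit.
Unset Printing Implicit Defensive.
Local Open Scope ring_scope.

(** Write p for the Turan density of H, m for its density parameter m(H), and
N for the number of edges of the complete l-uniform hypergraph on n vertices.

The lists are random k-subsets of a palette of P = C k colours, C a large
constant.  A colouring from the lists without monochromatic copy of H splits
the N edges into P hypergraphs without copy of H.  Each of these lies in one of
few containers, each having at most (p + eps) N edges
([free_hypergraph_containers]).  So a bad choice of lists comes with a P-tuple
of containers such that each edge lies in the container of some colour of its
list.  Fix the tuple.  If d of the P containers contain the edge e, then the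
list of e avoids these d colours with probability at least
(1 - d / P - k / P)^k, and these events are independent.  The average over e of
1 - d / P - k / P is at least a = 1 - p - eps - 1 / C, so by convexity the
probabilities add up to at least N a^k, and the tuple is bad for the lists with
probability at most exp (- N a^k) ([prod_covering_lists]).  There are
exp (O (N n^(-1/m) log n)) containers, so the union bound over the tuples
works once n^(1/m) is larger than a^(-k) by a polynomial factor in k.  As n is
exponential in k, polynomial factors disappear in the o(1); for the same reason
the containers can be counted crudely.

Containers come from a greedy process on the hypergraph whose vertices are the
N edges and whose edges are the copies of H.  Let I contain no copy of H.  The
edges of H are treated one after the other.  When the current one is e, there is
a family Phi of copies of H in which the images of all the edges treated before
lie in I.  While some vertex v of I is the image of e in many copies of Phi, v
is recorded and these copies are put in a new family Psi, except those
containing a set of images already contained in too many members of Psi.  If Psi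
gets large, e is done and Psi replaces Phi; this cannot happen for all the edges
of H, as I would then contain a copy of H.  If the process stops before, the set
X of those v that are the image of e in many copies is known from the recorded
vertices, is disjoint from I, and is large since few copies were discarded.  So
I lies in the container minus X; this is repeated as long as the container has
many edges, and hence, by supersaturation ([supersaturation]), contains many
copies of H.  The number of containers is bounded by the number of sequences of
recorded vertices. *)

(** * Bounds on binomial coefficients and powers *)

Section BinomialBounds.
Local Open Scope nat_scope.

Lemma leq_ffact_expn n k : n ^_ k <= n ^ k.
Proof.
elim: k => [|k IHk]; first by rewrite ffactn0.
by rewrite ffactnSr expnSr leq_mul // leq_subr.
Qed.

Lemma leq_bin_expn n l : 'C(n, l) <= n ^ l.
Proof.
apply: leq_trans (leq_ffact_expn n l).
by rewrite -bin_ffact leq_pmulr // fact_gt0.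
Qed.

Lemma leq_expn_ffact m s : m ^ s <= (m + s) ^_ s.
Proof.
elim: s => [|s IHs]; first by rewrite ffactn0.
by rewrite addnS ffactSS expnS leq_mul // -addnS leq_addr.
Qed.

Lemma leq_expn_ffact_double n s : 2 * s <= n -> n ^ s <= 2 ^ s * n ^_ s.
Proof.
move=> le2; have le_sn : s <= n by apply: leq_trans le2; rewrite leq_pmull.
rewrite -{2}(subnK le_sn); apply: (@leq_trans (2 ^ s * (n - s) ^ s)).
  rewrite -expnMn; case: (posnP s) => [->//|s0]; rewrite leq_exp2r //.
  by rewrite mulnBr [2 * n]mul2n -addnn -addnBA // leq_addr.
by rewrite leq_mul // leq_expn_ffact.
Qed.

Lemma leq_expn_bin n l : 2 * l <= n -> n ^ l <= 2 ^ l * l`! * 'C(n, l).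
Proof.
by move=> le_n; rewrite -mulnA [l`! * _]mulnC bin_ffact leq_expn_ffact_double.
Qed.

End BinomialBounds.

Section PowerMean.
Variable R : realFieldType.

(** The graph of a convex function lies above its tangent at [a]. *)
Lemma expr_ge_tangent (a y : R) (k : nat) : 0 <= a -> 0 <= y ->
  a ^+ k + k%:R * a ^+ k.-1 * (y - a) <= y ^+ k.
Proof.
move=> a0 y0; elim: k => [|[|k] IHk]; first by rewrite !expr0 !mul0r addr0.
  by rewrite !expr1 expr0; lra.
rewrite [leRHS]exprS; apply: le_trans (ler_wpM2l y0 IHk).
rewrite -subr_ge0 /= (_ : _ - _ = k.+1%:R * a ^+ k * (y - a) ^+ 2).
  by rewrite mulr_ge0 ?sqr_ge0 ?mulr_ge0 ?exprn_ge0.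
by rewrite !exprS -!natr1; ring.
Qed.

(** Jensen's inequality for the power function: summing the tangent at [a]
suffices, since its slope is nonnegative. *)
Lemma sum_expr_ge (I : finType) (A : {set I}) (z : I -> R) (a : R) (k : nat) :
  0 <= a -> (forall i, i \in A -> 0 <= z i) ->
  #|A|%:R * a <= \sum_(i in A) z i ->
  #|A|%:R * a ^+ k <= \sum_(i in A) z i ^+ k.
Proof.
move=> a0 z0 sumz.
apply: le_trans (_ : \sum_(i in A) (a ^+ k + k%:R * a ^+ k.-1 * (z i - a)) <= _).
  rewrite big_split /= -mulr_sumr sumr_const -[leLHS]addr0 mulr_natl lerD2l.
  rewrite mulr_ge0 ?mulr_ge0 ?exprn_ge0 // sumrB sumr_const subr_ge0.
  by rewrite -mulr_natl.
by apply: ler_sum => i iA; apply: expr_ge_tangent => //; apply: z0.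
Qed.

Lemma bernoulli_ge (x : R) k : 1 <= x -> 1 + k%:R * (x - 1) <= x ^+ k.
Proof.
move=> x1; have := expr_ge_tangent k ler01 (le_trans ler01 x1).
by rewrite !expr1n mulr1.
Qed.

End PowerMean.

(** * Families of small sets covering a class of sets *)

Section Covers.
Variables (V : finType) (small : pred {set V}).
Implicit Types (P Q : {set V} -> Prop) (I C : {set V}).

(** The classes [P] of interest are those of the independent sets compatible with a
partial history of the greedy process. Case distinctions on the next step of
the process become unions of classes, so the family of containers is built by
induction and no encoding of histories is needed. *)
Definition covered (M : nat) P : Prop :=
  exists2 Cs : seq {set V}, (size Cs <= M)%N &
    all small Cs /\ forall I, P I -> exists2 C, C \in Cs & I \subset C.

Lemma covered_leq M N P : (M <= N)%N -> covered M P -> covered N P.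
Proof. by move=> leMN [Cs sz H]; exists Cs => //; apply: leq_trans leMN. Qed.

Lemma covered_imp M P Q : (forall I, Q I -> P I) -> covered M P -> covered M Q.
Proof. by move=> QP [Cs sz [sm H]]; exists Cs => //; split=> // I /QP/H. Qed.

Lemma covered_small C : small C -> covered 1 (fun I => I \subset C).
Proof.
move=> smC; exists [:: C] => //; split=> [|I IC]; first by rewrite /= smC.
by exists C; rewrite ?inE.
Qed.

Lemma covered_or M N P Q :
  covered M P -> covered N Q -> covered (M + N) (fun I => P I \/ Q I).
Proof.
move=> [Cs szC [smC HC]] [Ds szD [smD HD]]; exists (Cs ++ Ds).
  by rewrite size_cat leq_add.
split=> [|I [/HC[C CCs IC]|/HD[C CDs IC]]]; first by rewrite all_cat smC smD.
  by exists C => //; rewrite mem_cat CCs.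
by exists C => //; rewrite mem_cat CDs orbT.
Qed.

Lemma covered_exists (J : eqType) (s : seq J) M (P : J -> {set V} -> Prop) :
  (forall j, j \in s -> covered M (P j)) ->
  covered (size s * M) (fun I => exists2 j, j \in s & P j I).
Proof.
elim: s => [|j s IHs] H; first by exists [::] => //; split=> // I [].
have covs : covered (size s * M) (fun I => exists2 i, i \in s & P i I).
  by apply: IHs => i si; apply: H; rewrite inE si orbT.
have covj : covered M (P j) by apply: H; rewrite mem_head.
rewrite /= mulSn; apply: covered_imp (covered_or covj covs).
move=> I [i]; rewrite inE => /predU1P[->|si] PI; first by left.
by right; exists i.
Qed.

End Covers.

(** * Containers for the independent sets of a hypergraph *)

(** An abstract [r]-uniform hypergraph: the edges are the elements [phi] of [E0], and
[x j phi] is the [j]-th vertex of [phi]. The vertices of an edge are kept ordered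
and distinct edges may have the same vertices. This spares the links of the
hypergraph: a family of lower uniformity is a subset of [E0] in which the last
coordinates are ignored. *)
Section Containers.
Variables (R : realFieldType) (V E : finType) (r : nat).
Variables (x : 'I_r -> E -> V) (V0 : {set V}) (E0 : {set E}).
Variable small : pred {set V}.
Variables (q xi : R) (F : nat).
Implicit Types (A : {set 'I_r}) (Phi Psi : {set E}) (phi psi : E).
Implicit Types (I C X : {set V}).

Definition independent I : Prop :=
  forall phi, phi \in E0 -> ~ (forall j, x j phi \in I).

Definition induced_edges C : {set E} :=
  [set phi in E0 | [forall j, x j phi \in C]].

Definition agree A phi psi : bool := [forall j in A, x j phi == x j psi].

(** The set of prescribed vertices is given by an edge [phi] and a set [A] of its
coordinates, so that degrees are sums over edges and can be exchanged as in
[codegree_exchange]. *)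
Definition codegree A Phi phi : nat := #|[set psi in Phi | agree A phi psi]|.

(** The greedy process treats the coordinates from the last one down; those below
[i] are the ones still to be treated. *)
Definition initial (i : nat) A : bool := [forall j in A, (j < i)%N].

(** The degrees decay as in a random family, each prescribed vertex costing a factor
[q]. The empty [A] is left out: the size of the families is bounded below instead. *)
Definition bounded_codegrees (i : nat) (B : R) Phi : Prop :=
  forall A phi, (0 < #|A|)%N -> initial i A ->
    (codegree A Phi phi)%:R <= B * q ^+ #|A|.

Definition coord_degree (j : 'I_r) Phi (v : V) : nat :=
  #|[set psi in Phi | x j psi == v]|.

Lemma agree_sym A phi psi : agree A phi psi = agree A psi phi.
Proof. by apply: eq_forallb_in => j _; rewrite eq_sym. Qed.

Lemma agree_trans A phi psi chi :
  agree A phi psi -> agree A psi chi = agree A phi chi.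
Proof. by move/forall_inP=> H; apply: eq_forallb_in => j /H/eqP ->. Qed.

Lemma codegree_agree A Phi phi psi :
  agree A phi psi -> codegree A Phi phi = codegree A Phi psi.
Proof.
by move=> H; apply: eq_card => chi; rewrite !inE (agree_trans _ H).
Qed.

(** Both sides count the pairs in [Phi] and [Psi] that agree on [A]. *)
Lemma codegree_exchange A Phi Psi :
  (\sum_(phi in Phi) codegree A Psi phi = \sum_(psi in Psi) codegree A Phi psi)%N.
Proof.
have E1 (X Y : {set E}) : (\sum_(phi in X) codegree A Y phi =
   \sum_(phi in X) \sum_(psi in Y) agree A phi psi)%N.
  apply: eq_bigr => phi _; rewrite /codegree -sum1_card big_mkcond /=.
  rewrite [RHS]big_mkcond; apply: eq_bigr => psi _; rewrite inE.
  by case: (psi \in Y) => //=; case: agree.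
rewrite !E1 exchange_big /=; apply: eq_bigr => psi _; apply: eq_bigr => phi _.
by rewrite agree_sym.
Qed.

(** Markov's inequality for the degree in [Psi] of the edges of [Phi], whose sum is
known after exchanging the two families. *)
Lemma saturated_card A Phi Psi (B thr : R) : 0 < thr ->
  (forall psi, (codegree A Phi psi)%:R <= B) ->
  #|[set phi in Phi | thr <= (codegree A Psi phi)%:R]|%:R * thr
    <= #|Psi|%:R * B.
Proof.
move=> thr0 leB; set K := [set _ in _ | _].
apply: (@le_trans _ _ (\sum_(phi in K) (codegree A Psi phi)%:R)).
  rewrite mulr_natl -sumr_const; apply: ler_sum => phi.
  by rewrite inE => /andP[].
apply: (@le_trans _ _ (\sum_(phi in Phi) (codegree A Psi phi)%:R)).
  rewrite [leRHS](bigID (mem K)) /= -[leLHS]addr0 lerD ?sumr_ge0 //.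
  rewrite le_eqVlt; apply/orP; left; apply/eqP; apply: eq_bigl => phi.
  by rewrite /K inE andbA andbb.
rewrite -natr_sum codegree_exchange natr_sum mulr_natl -sumr_const.
exact: ler_sum.
Qed.

Lemma sum_coord_degree j Phi :
  (\sum_v coord_degree j Phi v = #|Phi|)%N.
Proof.
rewrite -sum1_card (partition_big (x j) xpredT) //=.
by apply: eq_bigr => v _; rewrite sum1dep_card; apply: eq_card => phi; rewrite !inE.
Qed.

(** An upper bound [D] on all degrees forces many vertices to have degree at least
[beta], if [beta] is smaller than the average degree. *)
Lemma coord_degree_sum_le j (W : {set V}) Phi (D beta : R) :
  (forall phi, phi \in Phi -> x j phi \in W) ->
  (forall v, (coord_degree j Phi v)%:R <= D) -> 0 <= beta ->
  #|Phi|%:R <= #|[set v in W | beta <= (coord_degree j Phi v)%:R]|%:R * D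
               + #|W|%:R * beta.
Proof.
move=> PhiW leD beta0; rewrite -(sum_coord_degree j) natr_sum.
set X := [set _ in _ | _].
rewrite (bigID (mem X)) /= lerD //.
  by rewrite mulr_natl -sumr_const; apply: ler_sum.
rewrite (bigID (mem W)) /= [X in _ + X]big1 ?addr0 => [|v /andP[_ vW]]; last first.
  apply/eqP; rewrite pnatr_eq0 cards_eq0; apply/eqP/setP=> phi.
  rewrite !inE; apply/negP => /andP[/PhiW + /eqP E1].
  by rewrite E1 (negPf vW).
apply: (@le_trans _ _ (\sum_(v in W) beta)); last first.
  by rewrite sumr_const mulr_natl.
rewrite [leRHS](bigID (fun v => v \notin X)) /= -[leLHS]addr0 lerD ?sumr_ge0 //.
rewrite (eq_bigl (fun v => (v \in W) && (v \notin X))); last first.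
  by move=> v; rewrite andbC.
apply: ler_sum => v /andP[vW]; rewrite !inE vW /= -ltNge; exact: ltW.
Qed.

(** The class of the independent sets that the process has to deal with when the
coordinates from [i] on have been treated and the surviving family is [Phi]. *)
Definition forced (i : nat) C Phi I : Prop :=
  [/\ independent I, I \subset C &
      forall phi (j : 'I_r), phi \in Phi -> (i <= j)%N -> x j phi \in I].

(** The ratio of size to degree bound of the families in the process drops at most by
this factor at each coordinate: at least a fraction [q / 2 ^+ (r + 2)] of the size
is kept, and the degree bound is multiplied by [2 * q]. *)
Definition kappa : R := 2 ^+ (r + 3).

Hypotheses (q_gt0 : 0 < q) (q_le1 : q <= 1) (xi_gt0 : 0 < xi).
Hypothesis qV0 : q * #|V0|%:R <= F%:R.

Lemma kappa_ge1 : 1 <= kappa.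
Proof. by rewrite exprn_ege1 // ler1n. Qed.

Lemma kappa_gt0 : 0 < kappa.
Proof. exact: lt_le_trans ltr01 kappa_ge1. Qed.

(** The edges of [Phi] that must not be added to [Psi], since their images on some
[A] already have half of the degree allowed in [Psi]. *)
Definition saturated (i : nat) (B : R) Phi Psi : {set E} :=
  [set phi in Phi | [exists A : {set 'I_r},
     [&& (0 < #|A|)%N, initial i A
       & B * q * q ^+ #|A| <= (codegree A Psi phi)%:R]]].

(** There are at most [2 ^+ r] sets [A], and [saturated_card] applies to each of them;
the powers of [q] in the two degree bounds cancel up to one factor [q]. *)
Lemma saturated_le i (B : R) Phi Psi : 0 < B -> bounded_codegrees i B Phi ->
  q * #|saturated i B Phi Psi|%:R <= 2 ^+ r * #|Psi|%:R.
Proof.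
move=> B0' bPhi.
pose SA A := [set phi in Phi | [&& (0 < #|A|)%N, initial i A
       & B * q * q ^+ #|A| <= (codegree A Psi phi)%:R]].
have leS : (#|saturated i B Phi Psi| <= \sum_(A : {set 'I_r}) #|SA A|)%N.
  rewrite -sum1_card.
  apply: (@leq_trans (\sum_(phi in saturated i B Phi Psi)
                        \sum_(A : {set 'I_r}) (phi \in SA A))%N).
    apply: leq_sum => phi; rewrite inE => /andP[phiP /existsP[A HA]].
    by rewrite (bigD1 A) //= inE phiP HA.
  rewrite exchange_big /=; apply: leq_sum => A _.
  rewrite -sum1_card [leqLHS]big_mkcond [leqRHS]big_mkcond.
  by apply: leq_sum => phi _; case: ifP => // _; case: (phi \in SA A).
apply: (@le_trans _ _ (q * \sum_(A : {set 'I_r}) #|SA A|%:R)).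
  by rewrite ler_pM2l // -natr_sum ler_nat.
rewrite mulr_sumr.
have -> : 2 ^+ r * #|Psi|%:R = \sum_(A : {set 'I_r}) #|Psi|%:R :> R.
  have cardA : #|{set 'I_r}| = (2 ^ r)%N.
    by rewrite -cardsT -powersetT card_powerset cardsT card_ord.
  by rewrite sumr_const cardA -[RHS]mulr_natl natrX.
apply: ler_sum => A _.
have [/andP[A0 iA]|nA] := boolP ((0 < #|A|)%N && initial i A); last first.
  rewrite (_ : SA A = set0) ?cards0 ?mulr0 //.
  by apply/setP=> phi; rewrite !inE [X in _ && X]andbA (negPf nA) andbF.
have qA : 0 < q ^+ #|A| by rewrite exprn_gt0.
have thr0 : 0 < B * q * q ^+ #|A| by rewrite !mulr_gt0.
have := @saturated_card A Phi Psi _ _ thr0 (fun psi => bPhi A psi A0 iA).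
have -> : [set phi in Phi | B * q * q ^+ #|A| <= (codegree A Psi phi)%:R] = SA A.
  by apply/setP => phi; rewrite !inE A0 iA.
rewrite (_ : _ * _ = (q * #|SA A|%:R) * (B * q ^+ #|A|)); last by ring.
by rewrite ler_pM2r // mulr_gt0.
Qed.

(** An edge is added to [Psi] only if it is not saturated, so just before that its
degree is below half of the bound. All the edges added together have the same
vertex [v] at coordinate [i], so they add at most the degree in [Phi] of a set with
one more coordinate, which is the other half. *)
Lemma bounded_codegrees_add (i : 'I_r) (B : R) Phi Psi v :
  bounded_codegrees i.+1 B Phi -> Psi \subset Phi ->
  bounded_codegrees i (2 * q * B) Psi ->
  bounded_codegrees i (2 * q * B)
    (Psi :|: [set phi in Phi :\: saturated i B Phi Psi | x i phi == v]).
Proof.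
move=> bPhi PsiPhi bPsi A phi A0 iA.
set New := [set _ in _ | _].
have split_le : (codegree A (Psi :|: New) phi <=
                 codegree A Psi phi + codegree A New phi)%N.
  apply: (leq_trans _ (leq_card_setU _ _)); apply: subset_leq_card.
  by apply/subsetP=> psi; rewrite !inE => /andP[/orP[->|->] ->] //; rewrite orbT.
have [New0|[psi]] := set_0Vmem [set psi in New | agree A phi psi].
  apply: le_trans (bPsi A phi A0 iA); rewrite ler_nat (leq_trans split_le) //.
  by rewrite /codegree New0 cards0 addn0.
rewrite inE => /andP[]; rewrite inE => /andP[]; rewrite !inE => /andP[nsat psiPhi] /eqP psiv agr.
rewrite psiPhi /= in nsat.
have psi_lt : (codegree A Psi psi)%:R < B * q * q ^+ #|A|.
  by rewrite ltNge; apply: contra nsat => ?; apply/existsP; exists A; rewrite A0 iA.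
have new_le : (codegree A New phi <= codegree (i |: A) Phi psi)%N.
  apply: subset_leq_card; apply/subsetP=> chi; rewrite !inE.
  move=> /andP[/andP[/andP[_ ->] /eqP chiv] agr'] /=.
  apply/forall_inP => j; rewrite !inE => /predU1P[->|jA]; first by rewrite psiv chiv.
  by rewrite -(eqP (forall_inP agr j jA)) (eqP (forall_inP agr' j jA)).
have iNA : i \notin A by apply/negP => /(forall_inP iA); rewrite ltnn.
have Phi_le : (codegree (i |: A) Phi psi)%:R <= B * q * q ^+ #|A|.
  apply: le_trans (bPhi _ psi _ _) _.
  - by rewrite cardsU1 iNA.
  - apply/forall_inP => j; rewrite !inE => /predU1P[->//|jA].
    by rewrite ltnW // ltnS (forall_inP iA).
  - by rewrite cardsU1 iNA add1n exprS mulrA.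
rewrite (codegree_agree Psi agr) in split_le.
apply: (@le_trans _ _ ((codegree A Psi psi)%:R + (codegree A New phi)%:R)).
  by rewrite -natrD ler_nat.
have : (codegree A New phi)%:R <= B * q * q ^+ #|A|.
  by apply: le_trans Phi_le; rewrite ler_nat.
rewrite (_ : 2 * q * B * _ = B * q * q ^+ #|A| + B * q * q ^+ #|A|); last by ring.
by move=> H; rewrite lerD // ltW.
Qed.

(** One coordinate [i] of the greedy process. Induction on the number [f] of vertices
that can still be recorded before [Psi] is large enough to replace [Phi]: either
the independent set contains a vertex of large degree among the edges that can
be added, and one of at most [#|V0|] choices is recorded, or it misses all these
vertices, and the smaller container [C :\: X] is handled by [stuck]. *)
Lemma phase_covered (i : 'I_r) C Phi (B : R) (M0 M : nat) :
  0 < B -> C \subset V0 -> Phi \subset induced_edges C ->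
  bounded_codegrees i.+1 B Phi ->
  kappa ^+ i.+1 * (4 * q * xi * B) <= #|Phi|%:R ->
  (forall X, X \subset C -> xi <= #|X|%:R ->
     covered small M0 (fun I => independent I /\ I \subset C :\: X)) ->
  (M0 <= M)%N ->
  (forall Psi, Psi \subset Phi -> bounded_codegrees i (2 * q * B) Psi ->
     kappa ^+ i * (4 * q * xi * (2 * q * B)) <= #|Psi|%:R ->
     covered small M (forced i C Psi)) ->
  forall (f : nat) Psi,
    Psi \subset Phi -> bounded_codegrees i (2 * q * B) Psi ->
    q * #|Phi|%:R / 2 ^+ (r + 2) <=
      #|Psi|%:R + f%:R * (#|Phi|%:R / (4 * #|V0|%:R)) ->
    covered small ((#|V0|.+1 ^ f) * M)
      (fun I => forced i.+1 C Phi I /\ forced i C Psi I).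
Proof.
move=> B_gt0 CV0 PhiC bPhi largePhi stuck M0M next.
have kx0 : 0 < 4 * q * xi * B by rewrite !mulr_gt0.
have kappa0 := kappa_gt0.
have Phi0 : 0 < #|Phi|%:R :> R.
  by apply: lt_le_trans largePhi; rewrite mulr_gt0 // exprn_gt0.
have xC phi : phi \in Phi -> x i phi \in C.
  by move/(subsetP PhiC); rewrite inE => /andP[_ /forallP/(_ i)].
have N0 : 0 < #|V0|%:R :> R.
  rewrite ltr0n; move: Phi0; rewrite ltr0n => /card_gt0P[phi /xC/(subsetP CV0) Cphi].
  by apply/card_gt0P; exists (x i phi).
set beta := #|Phi|%:R / _.
have beta0 : 0 <= beta by rewrite divr_ge0 ?mulr_ge0 // ltW.
set w := 2 ^+ (r + 2); set u := 2 ^+ r : R.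
have u1 : 1 <= u by rewrite exprn_ege1 // ler1n.
(* q / w is the least fraction of Phi kept in Psi; u bounds the number of sets of coordinates. *)
have wE : w = u * 4 by rewrite /w exprD -/u; ring.
have nextP Psi : q * #|Phi|%:R / w <= #|Psi|%:R ->
    kappa ^+ i * (4 * q * xi * (2 * q * B)) <= #|Psi|%:R.
  apply: le_trans; rewrite ler_pdivlMr ?wE ?mulr_gt0 // ?(lt_le_trans ltr01) //.
  apply: le_trans (ler_wpM2l (ltW q_gt0) largePhi).
  rewrite le_eqVlt; apply/orP; left; apply/eqP.
  by rewrite exprS {2}/kappa exprD -/u; ring.
elim=> [|f IHf] Psi PsiPhi bPsi enough.
(* Stop as soon as Psi is large; otherwise few edges are saturated. *)
all: have [large|few] := leP (q * #|Phi|%:R / w) #|Psi|%:R.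
- apply: covered_leq (covered_imp _ (next Psi PsiPhi bPsi _)).
  + by rewrite mul1n.
  + by move=> I [].
  + exact: nextP.
- by rewrite mul0r addr0 leNgt few in enough.
- apply: covered_leq (covered_imp _ (next Psi PsiPhi bPsi _)).
  + by rewrite leq_pmull // expn_gt0.
  + by move=> I [].
  + exact: nextP.
set Sat := saturated i B Phi Psi.
pose G := (Phi :\: Sat) :\: Psi.
have few' : #|Psi|%:R * u * 4 < q * #|Phi|%:R.
  by rewrite -mulrA -wE -ltr_pdivlMr // wE mulr_gt0 // (lt_le_trans ltr01).
have Psi_le : #|Psi|%:R <= #|Phi|%:R / 4 :> R.
  have : #|Psi|%:R <= #|Psi|%:R * u by rewrite ler_peMr.
  have : q * #|Phi|%:R <= #|Phi|%:R by rewrite ler_piMl // ltW.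
  lra.
have Sat_le : #|Sat|%:R <= #|Phi|%:R / 4 :> R.
  have bPhi' : bounded_codegrees i B Phi.
    move=> A phi A0 iA; apply: bPhi => //.
    by apply/forall_inP => j /(forall_inP iA); apply: ltnW.
  have := saturated_le Psi B_gt0 bPhi'; rewrite -/Sat -/u => qSat.
  rewrite -(ler_pM2l q_gt0); lra.
have G_ge : #|Phi|%:R / 2 <= #|G|%:R :> R.
  have : (#|Phi| <= #|G| + #|Psi| + #|Sat|)%N.
    apply: (@leq_trans #|(G :|: Psi) :|: Sat|).
      apply: subset_leq_card; apply/subsetP=> phi phiPhi.
      rewrite !(in_setU, in_setD) phiPhi.
      by case: (phi \in Psi) => //; case: (phi \in Sat).
    have [le1 _] := leq_card_setU (G :|: Psi) Sat; apply: leq_trans le1 _.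
    by rewrite leq_add2r; case: (leq_card_setU G Psi).
  rewrite -(ler_nat R) !natrD; lra.
pose X := [set v in C | beta <= (coord_degree i G v)%:R].
have degG v : (coord_degree i G v)%:R <= B * q.
  rewrite /coord_degree.
  have [->|[psi]] := set_0Vmem [set psi in G | x i psi == v].
    by rewrite cards0 mulr_ge0 // ltW.
  rewrite inE => /andP[_ /eqP psiv].
  have := bPhi [set i] psi; rewrite cards1 expr1 => bi.
  apply: le_trans (bi isT _).
    rewrite ler_nat; apply: subset_leq_card; apply/subsetP=> phi.
    rewrite !inE => /andP[/andP[_ /andP[_ ->]] /eqP phiv].
    by apply/forall_inP=> j; rewrite inE => /eqP->; rewrite phiv psiv.
  by apply/forall_inP=> j; rewrite inE => /eqP->.
have xiX : xi <= #|X|%:R.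
  have GC phi : phi \in G -> x i phi \in C.
    by rewrite !inE => /andP[_ /andP[_ /xC]].
  have := coord_degree_sum_le GC degG beta0; rewrite -/X.
  have : #|C|%:R * beta <= #|Phi|%:R / 4.
    rewrite (_ : _ / 4 = #|V0|%:R * beta); last by rewrite /beta; field; rewrite gt_eqF.
    by rewrite ler_wpM2r // ler_nat subset_leq_card.
  have : 4 * q * xi * B <= #|Phi|%:R.
    apply: le_trans largePhi; apply: (ler_peMl (ltW kx0)).
    exact: exprn_ege1 kappa_ge1.
  move=> h1 h2 h3; rewrite -(ler_pM2r (mulr_gt0 B_gt0 q_gt0)); lra.
have XC : X \subset C by apply/subsetP => v; rewrite inE => /andP[].
pose Add v := Psi :|: [set phi in Phi :\: Sat | x i phi == v].
have covX : covered small (size (enum X) * (#|V0|.+1 ^ f * M))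
   (fun I => exists2 v, v \in enum X & forced i.+1 C Phi I /\ forced i C (Add v) I).
  apply: covered_exists => v; rewrite mem_enum => vX; apply: IHf.
  - rewrite subUset PsiPhi; apply/subsetP=> phi.
    by rewrite !inE => /andP[/andP[_ ->]].
  - exact: bounded_codegrees_add.
  - apply: le_trans enough _; rewrite -natr1 mulrDl mul1r addrA [leLHS]addrAC.
    rewrite lerD2r; move: vX; rewrite inE => /andP[_ bv].
    apply: le_trans (_ : #|Psi|%:R + (coord_degree i G v)%:R <= _).
      by rewrite lerD2l.
    rewrite -natrD ler_nat /coord_degree /Add.
    rewrite -cardsUI (_ : Psi :&: _ = set0) ?cards0 ?addn0.
      apply: subset_leq_card; apply/subsetP=> phi; rewrite !inE.
      by case: (phi \in Psi) => //= /andP[-> ->].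
    by apply/setP => phi; rewrite !inE; case: (phi \in Psi).
apply: covered_leq (covered_imp _ (covered_or covX (stuck X XC xiX))).
  rewrite expnS -mulnA mulSn addnC -cardE leq_add //.
    by rewrite (leq_trans M0M) // leq_pmull // expn_gt0.
  by rewrite leq_mul2r (subset_leq_card (subset_trans XC CV0)) orbT.
move=> I [[indI IC forcedPhi] [_ _ forcedPsi]].
have [disj|] := boolP (I \subset C :\: X); first by right.
case/subsetPn => v vI; rewrite inE negb_and negbK (subsetP IC) // orbF => vX.
left; exists v; rewrite ?mem_enum //; split; first by split.
split=> // phi j; rewrite !inE => /orP[|/andP[/andP[_ phiPhi] /eqP phiv]].
  exact: forcedPsi.
rewrite leq_eqVlt => /predU1P[/val_inj <-|]; first by rewrite phiv.
exact: forcedPhi.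
Qed.

(** Induction on the number [i] of coordinates left. For [i = 0] the class is empty,
as all vertices of any member of [Phi] lie in the independent set. *)
Lemma level_covered C (M0 : nat) : C \subset V0 ->
  (forall X, X \subset C -> xi <= #|X|%:R ->
     covered small M0 (fun I => independent I /\ I \subset C :\: X)) ->
  forall (i : nat) Phi (B : R), (i <= r)%N -> 0 < B ->
    Phi \subset induced_edges C -> bounded_codegrees i B Phi ->
    kappa ^+ i * (4 * q * xi * B) <= #|Phi|%:R ->
    covered small (#|V0|.+1 ^ (i * F) * M0) (forced i C Phi).
Proof.
move=> CV0 stuck; elim=> [|i IHi] Phi B ir B_gt0 PhiC bPhi largePhi.
  have : 0 < #|Phi|%:R :> R.
    by apply: lt_le_trans largePhi; rewrite expr0 mul1r !mulr_gt0.
  rewrite ltr0n => /card_gt0P[phi phiPhi].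
  exists [::] => //; split=> // I [indI _ forcedI]; exfalso.
  move/(subsetP PhiC): (phiPhi); rewrite inE => /andP[/indI + _].
  by apply=> j; apply: forcedI.
(* The phase starts from an empty Psi and may record up to F vertices. *)
have set00 : bounded_codegrees i (2 * q * B) set0.
  move=> A phi _ _; rewrite /codegree (_ : [set _ in _ | _] = set0).
    by rewrite cards0 !mulr_ge0 ?exprn_ge0 // ltW.
  by apply/setP => psi; rewrite !inE.
have := @phase_covered (Ordinal ir) C Phi B M0 (#|V0|.+1 ^ (i * F) * M0)
  B_gt0 CV0 PhiC bPhi largePhi stuck _ _ F set0 (sub0set _) set00 _.
rewrite mulnA -expnD -mulSn => H; apply: covered_imp (H _ _ _).
- by move=> I fI; split=> //; case: fI => indI IC _; split=> // phi j; rewrite inE.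
- by rewrite leq_pmull // expn_gt0.
- move=> Psi PsiPhi bPsi largePsi; apply: IHi bPsi largePsi.
  + exact: ltnW.
  + by rewrite !mulr_gt0.
  + exact: subset_trans PhiC.
- rewrite cards0 add0r.
  have Phi0 : 0 < #|Phi|%:R :> R.
    by apply: lt_le_trans largePhi; rewrite !mulr_gt0 ?exprn_gt0 ?kappa_gt0.
  have N0 : 0 < #|V0|%:R :> R.
    rewrite ltr0n; move: Phi0; rewrite ltr0n => /card_gt0P[phi phiPhi].
    move/(subsetP PhiC): phiPhi; rewrite inE => /andP[_ /forallP xC].
    by apply/card_gt0P; exists (x (Ordinal ir) phi); apply: (subsetP CV0).
  apply: (@le_trans _ _ (q * #|Phi|%:R / 4)).
    rewrite ler_pM2l ?mulr_gt0 // lef_pV2 ?posrE ?exprn_gt0 //.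
    by rewrite exprD (_ : 2 ^+ 2 = 4) ?ler_peMl ?exprn_ege1 ?ler1n //; ring.
  rewrite (_ : _ / 4 = q * #|V0|%:R * (#|Phi|%:R / (4 * #|V0|%:R))).
    by rewrite ler_wpM2r // divr_ge0 // ?mulr_ge0 // ltW.
  by field; rewrite gt_eqF.
Qed.

(** Each round of the process removes at least [xi] vertices from the container, so there are
at most [g] rounds. *)
Theorem containers (B : R) (g : nat) :
  0 < B -> bounded_codegrees r B E0 -> small set0 ->
  (forall C, C \subset V0 -> small C \/
     kappa ^+ r * (4 * q * xi * B) <= #|induced_edges C|%:R) ->
  #|V0|%:R <= g%:R * xi ->
  covered small (#|V0|.+1 ^ (g * (r * F)))
    (fun I => independent I /\ I \subset V0).
Proof.
move=> B_gt0 bE0 small0 supersat V0g.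
suff H C : C \subset V0 -> #|C|%:R <= g%:R * xi ->
  covered small (#|V0|.+1 ^ (g * (r * F))) (fun I => independent I /\ I \subset C).
  exact: H.
elim: g {V0g} C => [|g IHg] C CV0 leC.
  apply: covered_imp (covered_small small0) => I [_].
  suff -> : C = set0 by [].
  by apply/eqP; rewrite -cards_eq0 -(pnatr_eq0 R) eq_le ler0n (le_trans leC) // mul0r.
have [smC|largeC] := supersat C CV0.
  apply: covered_leq (covered_imp _ (covered_small smC)) => [|I []//].
  by rewrite expn_gt0.
have stuck X : X \subset C -> xi <= #|X|%:R ->
    covered small (#|V0|.+1 ^ (g * (r * F))) (fun I => independent I /\ I \subset C :\: X).
  move=> XC xiX; apply: IHg; first exact: subset_trans (subsetDl _ _) CV0.
  have : (#|C| = #|X| + #|C :\: X|)%N.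
    by rewrite -(cardsID X C) (setIidPr XC).
  move/(congr1 (fun n => n%:R : R)); rewrite natrD; move: leC xiX.
  rewrite -natr1; lra.
have bC : bounded_codegrees r B (induced_edges C).
  move=> A phi A0 iA; apply: le_trans (bE0 A phi A0 iA).
  rewrite ler_nat; apply: subset_leq_card; apply/subsetP=> psi.
  by rewrite !inE => /andP[/andP[-> _] ->].
have := level_covered CV0 stuck (leqnn r) B_gt0 (subxx _) bC largeC.
rewrite -expnD -mulSn; apply: covered_imp => I [indI IC]; split=> // phi j _.
by rewrite leqNgt ltn_ord.
Qed.

End Containers.

(** * Averaging over injections *)

Section Counting.
Local Open Scope nat_scope.

(** List [S] before its complement, and [S'] before its complement; the map sends each
element of the first list to the element of the second list at the same index. *)
Lemma exists_perm_imset (W : finType) (S S' : {set W}) :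
  #|S| = #|S'| -> exists p : W -> W, injective p /\ p @: S = S'.
Proof.
move=> eqS; pose s (X : {set W}) := enum X ++ enum (~: X).
have s_uniq X : uniq (s X).
  rewrite cat_uniq !enum_uniq andbT; apply/hasPn => y.
  by rewrite !mem_enum inE.
have s_mem X y : y \in s X by rewrite mem_cat !mem_enum inE orbN.
have s_size X : size (s X) = #|W| by rewrite size_cat -!cardE cardsC.
pose p y := nth y (s S') (index y (s S)).
have p_inj : injective p.
  move=> y z; rewrite /p (set_nth_default y) ?s_size -?(s_size S) ?index_mem //.
  move/eqP; rewrite nth_uniq ?s_size -?(s_size S) ?index_mem // => /eqP eqi.
  by rewrite -[LHS](nth_index y (s_mem S y)) eqi nth_index.
exists p; split=> //; apply/eqP; rewrite eqEcard card_imset // eqS leqnn andbT.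
apply/subsetP => _ /imsetP[y yS ->].
have iy : index y (s S) < size (enum S').
  by rewrite -cardE -eqS cardE index_cat mem_enum yS index_mem mem_enum.
by rewrite /p nth_cat iy -mem_enum mem_nth.
Qed.

Lemma card_ffun_constrained (A W : finType) (U : {set A}) (D : A -> {set W}) b :
  (forall y, y \in U -> #|D y| <= b) ->
  #|[set g : {ffun A -> W} | [forall y in U, g y \in D y]]|
    <= b ^ #|U| * #|W| ^ (#|A| - #|U|).
Proof.
move=> leb; pose D' y := if y \in U then D y else setT.
rewrite (_ : #|_| = #|family D'|); last first.
  apply: eq_card => g; rewrite !inE; apply/forall_inP/familyP => [H y|H y yU].
    by rewrite /D'; case: ifP => [/H//|_]; rewrite inE.
  by have := H y; rewrite /D' yU.
rewrite card_family foldrE big_map big_enum /=.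
rewrite (bigID (mem U)) /= leq_mul //.
  rewrite -prod_nat_const; apply: leq_prod => y yU.
  by rewrite /D' yU leb.
rewrite (eq_bigr (fun=> #|W|)) => [|y yU]; last first.
  by rewrite /D' (negPf yU); rewrite cardsT.
rewrite prod_nat_const -(cardC U) addKn; exact: leqnn.
Qed.

Definition injections (A W : finType) : {set {ffun A -> W}} :=
  [set g : {ffun A -> W} | injectiveb g].

(** By symmetry the image of [e] under a uniformly random injection is a uniformly
random [l]-set. *)
Lemma injections_image_card (A W : finType) (l : nat) (e : {set A})
    (G : {set {set W}}) :
  #|e| = l -> {in G, forall S : {set W}, #|S| = l} ->
  'C(#|W|, l) * #|[set g : {ffun A -> W} in injections A W | g @: e \in G]|
    = #|G| * #|W| ^_ #|A|.
Proof.
move=> el Gl.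
pose fib (S : {set W}) := [set g : {ffun A -> W} in injections A W | g @: e == S].
have fib_le (S S' : {set W}) : #|S| = #|S'| -> #|fib S| <= #|fib S'|.
  move=> /exists_perm_imset[p [p_inj pS]].
  pose P (g : {ffun A -> W}) := [ffun y => p (g y)].
  have P_inj : injective P.
    by move=> g h /ffunP E; apply/ffunP => y; move: (E y); rewrite !ffunE => /p_inj.
  rewrite -(card_imset _ P_inj); apply: subset_leq_card.
  apply/subsetP => _ /imsetP[g + ->]; rewrite !inE => /andP[/injectiveP gi /eqP gS].
  apply/andP; split.
    by apply/injectiveP => y z; rewrite !ffunE => /p_inj/gi.
  rewrite -pS -gS -imset_comp; apply/eqP/eq_imset => y; by rewrite ffunE.
have fib_eq (S S' : {set W}) : #|S| = #|S'| -> #|fib S| = #|fib S'|.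
  by move=> E; apply/eqP; rewrite eqn_leq !fib_le.
have sum_fib (X : {set {set W}}) :
    \sum_(S in X) #|fib S| = #|[set g : {ffun A -> W} in injections A W | g @: e \in X]|.
  rewrite -[RHS]sum1_card (partition_big (fun g : {ffun A -> W} => g @: e) (mem X)) /=.
    apply: eq_bigr => S XS; rewrite -sum1_card; apply: eq_bigl => g.
    by rewrite !inE; case: eqP => [->|]; rewrite ?andbF // XS !andbT.
  by move=> g; rewrite !inE => /andP[].
have [->|[S0 S0G]] := set_0Vmem G.
  rewrite cards0 mul0n (_ : [set _ in _ | _] = set0) ?cards0 ?muln0 //.
  by apply/setP=> g; rewrite !inE andbF.
have fibE (S : {set W}) : #|S| = l -> #|fib S| = #|fib S0|.
  by move=> Sl; apply: fib_eq; rewrite Sl Gl.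
rewrite -sum_fib (eq_bigr (fun=> #|fib S0|)) => [|S SG]; last by rewrite fibE ?Gl.
rewrite sum_nat_const mulnCA; congr (_ * _).
rewrite -card_draws -card_inj_ffuns.
rewrite [RHS](_ : _ = #|[set g : {ffun A -> W} in injections A W | g @: e \in
   [set S : {set W} | #|S| == l]]|).
  rewrite -sum_fib (eq_bigr (fun=> #|fib S0|)) ?sum_nat_const // => S.
  by rewrite inE => /eqP/fibE.
apply: eq_card => g; rewrite !inE.
by case: injectiveP => //= gi; rewrite card_imset // el eqxx.
Qed.

Definition pullback (A W : finType) (g : {ffun A -> W}) (G : {set {set W}}) :
  {set {set A}} := [set e : {set A} | g @: e \in G].

(** A random injection preserves the expected edge density. *)
Lemma sum_pullback (A W : finType) (l : nat) (G : {set {set W}}) :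
  {in G, forall S : {set W}, #|S| = l} ->
  'C(#|W|, l) * \sum_(g in injections A W) #|pullback g G|
    = 'C(#|A|, l) * (#|G| * #|W| ^_ #|A|).
Proof.
move=> Gl.
have -> : \sum_(g in injections A W) #|pullback g G| =
   \sum_(e in [set e : {set A} | #|e| == l])
     #|[set g : {ffun A -> W} in injections A W | g @: e \in G]|.
  transitivity (\sum_(g in injections A W)
      \sum_(e in [set e : {set A} | #|e| == l]) (g @: e \in G)).
    apply: eq_bigr => g; rewrite inE => /injectiveP gi.
    rewrite -sum1_card [LHS]big_mkcond [RHS]big_mkcond; apply: eq_bigr => e _.
    rewrite !inE; case: (boolP (g @: e \in G)) => [/Gl|]; last by case: ifP.
    by rewrite card_imset // => ->; rewrite eqxx.
  rewrite exchange_big; apply: eq_bigr => e _ /=.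
  rewrite -sum1_card [LHS]big_mkcond [RHS]big_mkcond; apply: eq_bigr => g _.
  by rewrite [in RHS]inE; case: (g \in injections A W) => //=; case: (_ \in G).
rewrite big_distrr /= (eq_bigr (fun=> #|G| * #|W| ^_ #|A|)).
  by rewrite sum_nat_const card_draws.
by move=> e; rewrite inE => /eqP el; apply: injections_image_card.
Qed.

End Counting.

(** * Turan numbers and supersaturation *)

Section TuranCounting.
Variables (l : nat) (T : finType) (H : {set {set T}}).
Local Open Scope nat_scope.

Definition copies (W : finType) (G : {set {set W}}) : {set {ffun T -> W}} :=
  [set f in injections T W | [forall e in H, f @: (e : {set T}) \in G]].

Lemma contains_copyE (W : finType) (G : {set {set W}}) :
  contains_copy H G = (copies G != set0).
Proof.
apply/existsP/set0Pn => -[f Hf]; exists f; first by rewrite !inE.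
by move: Hf; rewrite !inE.
Qed.

Lemma uniformP (W : finType) (G : {set {set W}}) :
  reflect {in G, forall S : {set W}, #|S| = l} (uniform_hypergraph l G).
Proof. by apply: (iffP forall_inP) => HG S /HG => [/eqP//|->]. Qed.

Lemma pullback_uniform (A W : finType) (g : {ffun A -> W}) G :
  injective g -> uniform_hypergraph l G -> uniform_hypergraph l (pullback g G).
Proof.
move=> gi /uniformP uG; apply/uniformP => e; rewrite inE => /uG.
by rewrite card_imset.
Qed.

Lemma pullback_copy (A W : finType) (g : {ffun A -> W}) G f0 :
  injective g -> f0 \in copies (pullback g G) ->
  [ffun a => g (f0 a)] \in copies G.
Proof.
move=> gi; rewrite !inE => /andP[/injectiveP f0i /forall_inP f0H].
apply/andP; split; first by apply/injectiveP=> a b; rewrite !ffunE => /gi/f0i.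
apply/forall_inP => e /f0H; rewrite inE -imset_comp.
rewrite (_ : [ffun a => g (f0 a)] @: e = (g \o f0) @: e) //.
by apply: eq_imset => a; rewrite ffunE.
Qed.

Lemma leq_extremal_number n (G : {set {set 'I_n}}) :
  uniform_hypergraph l G -> ~~ contains_copy H G ->
  #|G| <= extremal_number l H n.
Proof.
move=> uG fG; rewrite /extremal_number.
by rewrite (leq_bigmax_cond (F := fun G' : {set {set 'I_n}} => #|G'|)) ?uG.
Qed.

Lemma uniform_card_le n (G : {set {set 'I_n}}) :
  uniform_hypergraph l G -> #|G| <= 'C(n, l).
Proof.
move=> /uniformP uG; rewrite -[n in 'C(n, _)]card_ord -card_draws.
by apply: subset_leq_card; apply/subsetP => S /uG; rewrite inE => ->.
Qed.

(** The density of an [H]-free hypergraph is the average of the densities of its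
pullbacks to [s] vertices, which are [H]-free. *)
Lemma extremal_number_decreasing s n : s <= n ->
  extremal_number l H n * 'C(s, l) <= extremal_number l H s * 'C(n, l).
Proof.
move=> le_sn; rewrite [in leqLHS]/extremal_number.
apply: (big_ind (fun m => m * 'C(s, l) <= _)) => // [m1 m2 le1 le2|G].
  by rewrite maxnMl geq_max le1.
case/andP=> uG fG.
have np : 0 < n ^_ s by rewrite ffact_gt0.
rewrite -(leq_pmul2r np); have /uniformP/sum_pullback := uG => /(_ 'I_s).
rewrite !card_ord => E.
rewrite mulnAC mulnC -E -[leqRHS]mulnA [leqRHS]mulnC -[leqRHS]mulnA.
rewrite leq_mul2l; apply/orP; right.
apply: (@leq_trans (\sum_(g in injections 'I_s 'I_n) extremal_number l H s)).
  apply: leq_sum => g; rewrite inE => /injectiveP gi.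
  apply: leq_extremal_number; first exact: pullback_uniform.
  apply: contra fG; rewrite !contains_copyE => /set0Pn[f0 /pullback_copy f0G].
  by apply/set0Pn; exists [ffun a => g (f0 a)]; apply: f0G.
by rewrite sum_nat_const card_inj_ffuns !card_ord.
Qed.

(** The pullbacks to [s] vertices with more than [extremal_number l H s] edges contain a
copy of [H], and each copy of [H] in [G] comes from few injections. *)
Lemma supersaturation_count s n (G : {set {set 'I_n}}) : s <= n ->
  uniform_hypergraph l G ->
  'C(s, l) * (#|G| * n ^_ s) <=
  'C(n, l) * (n ^_ s * extremal_number l H s
               + s ^ #|T| * (#|copies G| * n ^ (s - #|T|)) * 'C(s, l)).
Proof.
move=> le_sn uG; have /uniformP/sum_pullback := uG => /(_ 'I_s).
rewrite !card_ord => <-; rewrite leq_mul2l; apply/orP; right.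
pose good := [set g in injections 'I_s 'I_n |
                extremal_number l H s < #|pullback g G|].
have good_le : #|good| <= s ^ #|T| * (#|copies G| * n ^ (s - #|T|)).
  pose ext f0 (f : {ffun T -> 'I_n}) := [set g : {ffun 'I_s -> 'I_n} |
     [forall y in f0 @: [set: T], g y \in [set z | [forall a, (f0 a == y) ==> (z == f a)]]]].
  apply: (@leq_trans (\sum_(f0 in injections T 'I_s) \sum_(f in copies G) #|ext f0 f|)).
    apply: (@leq_trans (\sum_(g in good) \sum_(f0 in injections T 'I_s)
              \sum_(f in copies G) (g \in ext f0 f))).
      rewrite -sum1_card; apply: leq_sum => g; rewrite inE => /andP[gI gt_ex].
      have gi : injective g by move: gI; rewrite inE => /injectiveP.
      have : contains_copy H (pullback g G).
        apply: contraTT gt_ex => fP; rewrite -leqNgt.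
        by apply: leq_extremal_number => //; apply: pullback_uniform.
      rewrite contains_copyE => /set0Pn[f0 f0P].
      have f0I : f0 \in injections T 'I_s by move: f0P; rewrite inE => /andP[].
      rewrite (bigD1 f0) //= (bigD1 _ (pullback_copy gi f0P)) /=.
      rewrite (_ : (g \in _) = true) // inE.
      apply/forall_inP=> y _; rewrite inE; apply/forallP=> a.
      by apply/implyP=> /eqP <-; rewrite ffunE.
    rewrite exchange_big; apply: leq_sum => f0 _.
    rewrite exchange_big; apply: leq_sum => f _ /=.
    rewrite -sum1_card [leqLHS]big_mkcond [leqRHS]big_mkcond.
    by apply: leq_sum => g _; case: ifP => _ //; case: (g \in ext f0 f).
  apply: (@leq_trans (\sum_(f0 in injections T 'I_s) #|copies G| * n ^ (s - #|T|))).
    apply: leq_sum => f0; rewrite inE => /injectiveP f0i.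
    rewrite -sum_nat_const; apply: leq_sum => f _.
    apply: leq_trans (card_ffun_constrained (b := 1) _) _ => [_ /imsetP[a _ ->]|].
      rewrite -(cards1 (f a)); apply: subset_leq_card; apply/subsetP => z.
      by rewrite !inE => /forallP/(_ a); rewrite eqxx.
    by rewrite exp1n mul1n !card_ord card_imset // cardsT.
  rewrite sum_nat_const leq_mul2r; apply/orP; right.
  rewrite -[X in _ <= X ^ _]card_ord -card_ffun; exact: max_card.
apply: (@leq_trans (\sum_(g in injections 'I_s 'I_n)
   (extremal_number l H s + (g \in good) * 'C(s, l)))).
  apply: leq_sum => g gI; rewrite inE gI /=; case: ltnP => le; last by rewrite addn0.
  rewrite mul1n (leq_trans _ (leq_addl _ _)) // uniform_card_le //.
  by apply: pullback_uniform => //; move: gI; rewrite inE => /injectiveP.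
rewrite big_split /= sum_nat_const card_inj_ffuns !card_ord leq_add2l.
rewrite -big_distrl /= leq_mul2r; apply/orP; right.
apply: leq_trans good_le; rewrite -sum1_card [leqLHS]big_mkcond [leqRHS]big_mkcond.
by apply: leq_sum => g _; case: ifP; case: (g \in good).
Qed.

End TuranCounting.

Section TuranDensity.
Variables (R : realType) (l : nat) (T : finType) (H : {set {set T}}).
Hypothesis H_uniform : uniform_hypergraph l H.
Let ratio (n : nat) : R := (extremal_number l H n)%:R / 'C(n, l)%:R.
(** The ratios are monotone only from [l] vertices on, being [0] below. *)
Let shifted (n : nat) : R := ratio (n + l).

Lemma ratio_decreasing : {homo shifted : m n / (m <= n)%N >-> n <= m}.
Proof.
move=> m n mn; rewrite /shifted /ratio.
have lmn : (m + l <= n + l)%N by rewrite leq_add2r.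
have c0 k : 0 < 'C(k + l, l)%:R :> R by rewrite ltr0n bin_gt0 leq_addl.
rewrite ler_pdivrMr // mulrAC ler_pdivlMr // -!natrM ler_nat.
exact: extremal_number_decreasing.
Qed.

Lemma turan_density_cvg : (shifted n @[n --> \oo] --> turan_density R l H)%classic.
Proof.
have cv : cvgn shifted.
  apply: nonincreasing_is_cvgn ratio_decreasing _.
  by exists 0 => _ [n _ <-]; rewrite divr_ge0.
suff -> : turan_density R l H = limn shifted by [].
by apply: cvg_lim => //; rewrite -(cvg_shiftn l).
Qed.

Lemma turan_density_ge0 : 0 <= turan_density R l H.
Proof.
rewrite -(cvg_lim _ turan_density_cvg) //.
apply: limr_ge; first by apply/cvg_ex; exists (turan_density R l H); apply: turan_density_cvg.
by apply: nearW => n; rewrite divr_ge0.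
Qed.

Lemma turan_density_approx (eps : R) (m : nat) : 0 < eps ->
  exists s, [/\ (m <= s)%N, (l <= s)%N &
    (extremal_number l H s)%:R <= (turan_density R l H + eps) * 'C(s, l)%:R].
Proof.
move=> eps0; have lt_eps : turan_density R l H < turan_density R l H + eps.
  by rewrite ltrDl.
have /filter_ex[n [mn le_n]] : (\forall n \near \oo, (m <= n)%N /\
    shifted n <= turan_density R l H + eps)%classic.
  by near=> n; split; near: n; [apply: nbhs_infty_ge|apply: cvgr_le turan_density_cvg _ lt_eps].
exists (n + l)%N; split; rewrite ?leq_addl ?(leq_trans mn) ?leq_addr //.
by rewrite -ler_pdivrMr // ltr0n bin_gt0 leq_addl.
Unshelve. all: by end_near.
Qed.

(** On [#|T|] vertices the complete hypergraph contains [H], so the density is already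
less than [1] there, and it does not increase afterwards. *)
Lemma turan_density_lt1 : (0 < #|H|)%N -> turan_density R l H < 1.
Proof.
case/card_gt0P => e eH.
have el : #|e| = l by apply/eqP/(forall_inP H_uniform).
have lt : (l <= #|T|)%N by rewrite -el max_card.
have := nonincreasing_cvgn_ge ratio_decreasing
  (cvgP _ turan_density_cvg) (#|T| - l)%N.
rewrite (cvg_lim _ turan_density_cvg) // /shifted subnK //.
move=> /le_lt_trans; apply; rewrite /ratio ltr_pdivrMr ?ltr0n ?bin_gt0 //.
rewrite mul1r ltr_nat.
apply: (big_ind (fun m => (m < 'C(#|T|, l))%N)) => [|m1 m2 lt1 lt2|G /andP[uG fG]].
- by rewrite bin_gt0.
- by rewrite gtn_max lt1.
rewrite ltnNge; apply: contra fG => leG; rewrite contains_copyE.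
have GE : G = [set S : {set 'I_#|T|} | #|S| == l].
  apply/eqP; rewrite eqEcard card_draws card_ord leG andbT.
  by apply/subsetP => S /(uniformP _ _ uG) Sl; rewrite inE Sl.
apply/set0Pn; exists [ffun a => enum_rank a].
have rI : injective [ffun a : T => enum_rank a].
  by move=> a b; rewrite !ffunE => /enum_rank_inj.
rewrite !inE; apply/andP; split; first exact/injectiveP.
by apply/forall_inP => d dH; rewrite GE inE card_imset // (forall_inP H_uniform).
Qed.

(** Fix [s] where the extremal density is within [eps / 2] of its limit; a random
pullback of [G] to [s] vertices exceeds it with probability at least [eps / 2]. *)
Lemma supersaturation (eps : R) : 0 < eps ->
  exists2 gamma : R, 0 < gamma & exists n0, forall n (G : {set {set 'I_n}}),
    (n0 <= n)%N -> uniform_hypergraph l G ->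
    (turan_density R l H + eps) * 'C(n, l)%:R <= #|G|%:R ->
    gamma * n%:R ^+ #|T| <= #|copies H G|%:R.
Proof.
move=> eps0; have eps2 : 0 < eps / 2 by rewrite divr_gt0.
have [s [ts ls ex_s]] := turan_density_approx #|T| eps2.
(* Nonzero even when s = 0, since then T is empty and the power is 1. *)
have st0 : 0 < (s ^ #|T|)%:R :> R.
  rewrite ltr0n expn_gt0; case: s ts {ls ex_s} => //.
  by rewrite leqn0 => ->.
have s20 : 0 < (2 ^ s)%:R :> R by rewrite ltr0n expn_gt0.
exists (eps / 2 / ((2 ^ s)%:R * (s ^ #|T|)%:R)); first by rewrite !divr_gt0 ?mulr_gt0.
exists (2 * s).+1 => n G ltn uG dense.
have sn : (s <= n)%N by apply: leq_trans (ltnW ltn); rewrite leq_pmull.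
have n0 : (0 < n)%N by apply: leq_trans ltn.
have cn0 : 0 < 'C(n, l)%:R :> R by rewrite ltr0n bin_gt0 (leq_trans ls).
have cs0 : 0 < 'C(s, l)%:R :> R by rewrite ltr0n bin_gt0.
have := supersaturation_count H sn uG.
rewrite -(ler_nat R) !natrM natrD !natrM => count.
have np : n%:R ^+ s <= (2 ^ s)%:R * (n ^_ s)%:R :> R.
  by rewrite -natrX -natrM ler_nat leq_expn_ffact_double // ltnW.
set K := #|copies H G|%:R.
have key : eps / 2 * (n ^_ s)%:R <= (s ^ #|T|)%:R * (K * n%:R ^+ (s - #|T|)).
  rewrite -(ler_pM2l cn0) -(ler_pM2l cs0).
  have p1 := ler_wpM2l (ltW cs0) (ler_wpM2r (ler0n R (n ^_ s)) dense).
  have p2 := ler_wpM2l (ltW cn0) (ler_wpM2l (ler0n R (n ^_ s)) ex_s).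
  rewrite (natrX _ n) -/K in count; lra.
have nst0 : 0 < n%:R ^+ (s - #|T|) :> R by rewrite exprn_gt0 // ltr0n.
rewrite mulrAC ler_pdivrMr ?mulr_gt0 // -(ler_pM2r nst0) -mulrA -exprD subnKC //.
apply: le_trans (ler_wpM2l (ltW eps2) np) _.
apply: le_trans (_ : (2 ^ s)%:R * (eps / 2 * (n ^_ s)%:R) <= _).
  by rewrite mulrCA.
by apply: le_trans (ler_wpM2l (ltW s20) key) _; rewrite le_eqVlt; apply/orP; left; apply/eqP; ring.
Qed.

End TuranDensity.

(** * Containers for H-free hypergraphs *)

Section HypergraphContainers.
Variables (R : realType) (l : nat) (T : finType) (H : {set {set T}}).
Hypothesis H_uniform : uniform_hypergraph l H.

(** The inequality behind the maximum in [max_density]. The case of a single edge is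
included, as the degree bounds are needed for it too. *)
Lemma density_bound (U : {set T}) (D : {set {set T}}) :
  D \subset H -> (forall e, e \in D -> e \subset U) -> (0 < #|D|)%N ->
  [/\ (l <= #|U|)%N &
     (#|D|.-1)%:R <= max_density R l H * (#|U| - l)%:R].
Proof.
move=> DH DU D0; have eql e : e \in D -> #|e| = l.
  by move=> /(subsetP DH)/(forall_inP H_uniform)/eqP.
case/card_gt0P: (D0) => e eD.
have lU : (l <= #|U|)%N by rewrite -(eql e eD) subset_leq_card ?DU.
split=> //; case: (ltnP 1 #|D|) => [D1|]; last first.
  case: #|D| D0 => // -[|//] _ _; rewrite mulr_ge0 // /max_density.
  by apply: bigmax_ge_id.
(* The denominator in max_density is positive, as two distinct l-sets span more
   than l vertices. *)
have lU' : (l < #|U|)%N.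
  rewrite ltnNge; apply/negP => leU.
  have eU d : d \in D -> d = U.
    by move=> dD; apply/eqP; rewrite eqEcard DU // (eql d dD).
  suff : (#|D| <= 1)%N by rewrite leqNgt D1.
  rewrite -(cards1 U); apply: subset_leq_card; apply/subsetP => d dD.
  by rewrite inE (eU d dD).
rewrite -ler_pdivrMr ?ltr0n ?subn_gt0 //.
have := @le_bigmax_cond _ _ _ (0 : R) (U, D)
  (fun H' : {set T} * {set {set T}} => subhypergraph H H' && (1 < #|H'.2|)%N)
  (fun H' => ((#|H'.2|%:R - 1) / (#|H'.1|%:R - l%:R))).
rewrite /= -subn1 !natrB //; apply; rewrite D1 andbT; apply/andP; split=> //.
exact/forall_inP.
Qed.

Lemma power_density_bound (y : R) (n u d : nat) :
  1 <= y -> y `^ max_density R l H <= n%:R ->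
  d%:R <= max_density R l H * u%:R -> y ^+ d <= n%:R ^+ u.
Proof.
move=> y1 yn du; have y0 : 0 <= y := le_trans ler01 y1.
rewrite -powR_mulrn //; apply: le_trans (ler_powR y1 du) _.
rewrite powRrM powR_mulrn ?powR_ge0 //.
by rewrite lerXn2r ?nnegrE ?powR_ge0.
Qed.

Definition edge_image n (j : 'I_#|H|) (f : {ffun T -> 'I_n}) : {set 'I_n} :=
  f @: enum_val j.

(** A copy of [H] agreeing with [phi] on the edges in [A] maps their union [U] into the
image of [U], which leaves [n ^ (#|T| - #|U|)] choices for the other vertices. The
density bound says that each edge in [A] but one costs a factor [y]. *)
Lemma codegree_copies (n : nat) (y : R) (A : {set 'I_#|H|}) phi :
  (0 < n)%N -> 1 <= y -> y `^ max_density R l H <= n%:R -> (0 < #|A|)%N ->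
  (codegree (@edge_image n) A (injections T 'I_n) phi)%:R <=
    #|T|%:R ^+ #|T| * n%:R ^+ (#|T| - l) * y * y^-1 ^+ #|A|.
Proof.
move=> n0 y1 yn A0; have y0 : 0 < y := lt_le_trans ltr01 y1.
pose D := [set enum_val j | j in A]; pose U := \bigcup_(j in A) enum_val j.
have DA : #|D| = #|A| by rewrite card_imset //; apply: enum_val_inj.
have DH : D \subset H by apply/subsetP => _ /imsetP[j _ ->]; apply: enum_valP.
have DU e : e \in D -> e \subset U.
  by case/imsetP=> j jA ->; apply: (bigcup_sup j).
have [|lU dU] := density_bound DH DU; first by rewrite DA.
rewrite DA in dU; have {dU} yU := power_density_bound y1 yn dU.
have leUT : (#|U| <= #|T|)%N by apply: max_card.
have count : (codegree (@edge_image n) A (injections T 'I_n) phi <=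
              #|T| ^ #|T| * n ^ (#|T| - #|U|))%N.
  apply: (@leq_trans (#|U| ^ #|U| * n ^ (#|T| - #|U|))%N); last first.
    rewrite leq_mul2r; apply/orP; right.
    case: (posnP #|U|) leUT => [->|U0] leUT.
      by rewrite expn0; case: (posnP #|T|) => [->//|T0]; rewrite expn_gt0 T0.
    apply: (@leq_trans (#|T| ^ #|U|)%N); first by rewrite leq_exp2r.
    by rewrite leq_pexp2l // (leq_trans U0).
  have := @card_ffun_constrained T 'I_n U (fun=> phi @: U) #|U|
            (fun _ _ => leq_imset_card _ _).
  rewrite card_ord; apply: leq_trans; apply: subset_leq_card.
  apply/subsetP => psi; rewrite !inE => /andP[_ /forall_inP agr].
  apply/forall_inP => z /bigcupP[j jA zj].
  have : psi z \in edge_image j phi by rewrite (eqP (agr j jA)) imset_f.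
  by apply: subsetP; apply: imsetS; apply: (bigcup_sup j).
apply: le_trans (_ : (#|T| ^ #|T| * n ^ (#|T| - #|U|))%N%:R <= _).
  by rewrite ler_nat.
rewrite natrM !natrX -!mulrA ler_wpM2l ?exprn_ge0 //.
rewrite (_ : #|T| - l = (#|T| - #|U|) + (#|U| - l))%N; last first.
  by rewrite addnBA // subnK.
rewrite exprD -mulrA ler_peMr ?exprn_ge0 // -(prednK A0) exprS.
rewrite [y * _]mulrA mulfV ?gt_eqF // mul1r exprVn.
by rewrite ler_pdivlMr ?exprn_gt0 // mul1r.
Qed.

Lemma free_independent n (I : {set {set 'I_n}}) :
  ~~ contains_copy H I -> independent (@edge_image n) (injections T 'I_n) I.
Proof.
rewrite contains_copyE negbK => /eqP noI phi phiI allI.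
have : phi \in set0 by rewrite -noI inE phiI; apply/forall_inP => e eH;
  have := allI (enum_rank_in eH e); rewrite /edge_image enum_rankK_in.
by rewrite inE.
Qed.

Lemma copies_induced n (C : {set {set 'I_n}}) :
  copies H C \subset induced_edges (@edge_image n) (injections T 'I_n) C.
Proof.
apply/subsetP => f; rewrite !inE => /andP[-> /forall_inP fC] /=.
by apply/forallP => j; apply: fC; apply: enum_valP.
Qed.

Definition sparse n (d : R) (C : {set {set 'I_n}}) : bool :=
  #|C|%:R <= d * 'C(n, l)%:R.

(** [containers] applied to the copies of [H] with [q = 1 / y]. The number of rounds
is bounded in terms of [H] and [eps], since both [xi] and the number of edges
have order [n ^ l]. *)
Theorem free_hypergraph_containers (eps : R) : 0 < eps -> (0 < #|H|)%N ->
  exists g n0 : nat, forall (n : nat) (y : R) (F : nat), (n0 <= n)%N ->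
    1 <= y -> y `^ max_density R l H <= n%:R -> 'C(n, l)%:R <= F%:R * y ->
    covered (@sparse n (turan_density R l H + eps)) ('C(n, l).+1 ^ (g * F))
      (fun I => ~~ contains_copy H I /\ I \subset complete_hypergraph l n).
Proof.
move=> eps0 H0; have [gamma gamma0 [n0 supersat]] := supersaturation l H eps0.
set t := #|T|; set r := #|H|; set kap : R := kappa R r.
have kap0 : 0 < kap ^+ r by rewrite exprn_gt0 // kappa_gt0.
case/card_gt0P: (H0) => e eH.
have lt : (l <= t)%N by rewrite -(eqP (forall_inP H_uniform e eH)) max_card.
have tt0 : 0 < t%:R ^+ t :> R.
  by case: (posnP t) => [->|t0]; rewrite ?expr0 // exprn_gt0 // ltr0n.
pose c : R := 4 * kap ^+ r * t%:R ^+ t / gamma.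
have c0 : 0 < c by rewrite divr_gt0 ?mulr_gt0.
exists ((Num.trunc c).+1 * r)%N, n0.+1 => n y F ln y1 yn NF.
have n_gt0 : (0 < n)%N by apply: leq_trans ln.
have nR0 : 0 < n%:R :> R by rewrite ltr0n.
have y0 : 0 < y := lt_le_trans ltr01 y1.
pose xi := n%:R ^+ l / c.
have V0E : #|complete_hypergraph l n| = 'C(n, l) by rewrite card_draws card_ord.
rewrite -mulnA -V0E.
have q0 : 0 < y^-1 by rewrite invr_gt0.
have q1 : y^-1 <= 1 by rewrite invf_le1.
have xi0 : 0 < xi by rewrite divr_gt0 ?exprn_gt0.
have qV0 : y^-1 * #|complete_hypergraph l n|%:R <= F%:R.
  by rewrite V0E mulrC ler_pdivrMr.
apply: covered_imp (containers (x := @edge_image n) (E0 := injections T 'I_n)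
  (B := t%:R ^+ t * n%:R ^+ (t - l) * y) q0 q1 xi0 qV0 _ _ _ _ _).
- by move=> I [fI Isub]; split=> //; apply: free_independent.
- by rewrite !mulr_gt0 // exprn_gt0.
- by move=> A phi A0 _; apply: codegree_copies.
- by rewrite /sparse cards0 mulr_ge0 // addr_ge0 ?turan_density_ge0 // ltW.
- move=> C CV; rewrite /sparse; case: lerP => [|/ltW dense]; first by left.
  right; apply: le_trans (_ : #|copies H C|%:R <= _); last first.
    by rewrite ler_nat subset_leq_card // copies_induced.
  have uC : uniform_hypergraph l C.
    by apply/forall_inP => S /(subsetP CV); rewrite inE.
  apply: le_trans (supersat n C (ltnW ln) uC dense).
  have cancel (k a b d z gm : R) : 0 < k -> 0 < d -> 0 < z -> 0 < gm ->
      k * (4 * z^-1 * (a / (4 * k * d / gm)) * (d * b * z)) = gm * (b * a).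
    by move=> k0 d0 z0 gm0; field; rewrite !gt_eqF.
  by rewrite -/t -[in leRHS](subnK lt) exprD /xi /c -/kap cancel.
- rewrite V0E; apply: (@le_trans _ _ (n%:R ^+ l)).
    by rewrite -natrX ler_nat leq_bin_expn.
  rewrite /xi mulrA ler_pdivlMr // mulrC ler_wpM2r ?exprn_ge0 //.
  by rewrite ltW // truncnS_gt.
Qed.

End HypergraphContainers.

(** * Random lists against a family of containers *)

Section RandomLists.
Variables (R : realType) (V : finType) (V0 : {set V}) (P k : nat).
Hypotheses (P_gt0 : (0 < P)%N) (k_leP : (k <= P)%N).

(** The probability that a random list of [k] colours avoids [d] given ones, bounded
below by a power with a base that is linear in [d], so that convexity applies. *)
Lemma bin_sub_ge (d : nat) :
  (('C(P, k) * (P - d - k) ^ k) <= 'C(P - d, k) * P ^ k)%N.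
Proof.
rewrite -(leq_pmul2r (fact_gt0 k)) mulnAC bin_ffact [leqRHS]mulnAC bin_ffact.
rewrite mulnC leq_mul ?leq_ffact_expn //.
have [le_k|lt_k] := leqP k (P - d).
  by rewrite -{2}(subnK le_k) leq_expn_ffact.
case: k lt_k => [//|j] lt_k; rewrite (_ : P - d - j.+1 = 0)%N ?exp0n //.
by apply/eqP; rewrite subn_eq0 ltnW.
Qed.

(** The values outside [V0] are pinned to [w0], so that only the choices on [V0] count. *)
Lemma card_family_on (W : finType) (D : V -> {set W}) (w0 : W) :
  #|[set L : {ffun V -> W} | [forall e, L e \in if e \in V0 then D e else [set w0]]]|
    = (\prod_(e in V0) #|D e|)%N.
Proof.
pose D' e := if e \in V0 then D e else [set w0].
rewrite (_ : #|_| = #|family D'|); last first.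
  apply: eq_card => L; rewrite !inE; apply/forallP/familyP => HL e.
    exact: HL.
  exact: HL.
rewrite card_family foldrE big_map big_enum /= [RHS]big_mkcond.
by apply: eq_bigr => e _; rewrite /D'; case: ifP => //; rewrite cards1.
Qed.

Definition colours_at (Ct : 'I_P -> {set V}) (e : V) : {set 'I_P} :=
  [set i | e \in Ct i].

(** The lists that allow [e] to receive a colour without leaving the containers. *)
Definition covering_lists (Ct : 'I_P -> {set V}) (e : V) : {set {set 'I_P}} :=
  [set A : {set 'I_P} | #|A| == k & ~~ (A \subset ~: colours_at Ct e)].

Lemma card_covering_lists Ct e :
  #|covering_lists Ct e| = ('C(P, k) - 'C(P - #|colours_at Ct e|, k))%N.
Proof.
have := cardsID [set A : {set 'I_P} | A \subset ~: colours_at Ct e]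
                [set A : {set 'I_P} | #|A| == k].
rewrite card_draws card_ord => <-.
rewrite (_ : _ :\: _ = covering_lists Ct e); last first.
  by apply/setP => A; rewrite !inE andbC.
rewrite (_ : #|_ :&: _| = 'C(P - #|colours_at Ct e|, k)) ?addKn //.
have -> : (P - #|colours_at Ct e| = #|~: colours_at Ct e|)%N.
  by rewrite [RHS]cardsCs setCK card_ord.
rewrite -cards_draws.
by apply: eq_card => A; rewrite !inE andbC.
Qed.

Lemma sum_colours_at (Ct : 'I_P -> {set V}) (theta : R) :
  (forall i, #|Ct i|%:R <= theta * #|V0|%:R) ->
  \sum_(e in V0) #|colours_at Ct e|%:R <= P%:R * (theta * #|V0|%:R).
Proof.
move=> leC; apply: (@le_trans _ _ (\sum_(i < P) #|Ct i|%:R)); last first.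
  rewrite -[P in leRHS]card_ord mulr_natl -sumr_const.
  by apply: ler_sum => i _.
rewrite -!natr_sum ler_nat.
apply: (@leq_trans (\sum_(e in V0) \sum_(i < P) (e \in Ct i))%N).
  apply: leq_sum => e _; rewrite -sum1_card big_mkcond; apply: leq_sum => i _.
  by rewrite inE; case: (e \in Ct i).
rewrite exchange_big; apply: leq_sum => i _ /=.
rewrite -sum1_card [leqLHS]big_mkcond [leqRHS]big_mkcond.
by apply: leq_sum => e _; case: ifP => // _; case: (e \in Ct i).
Qed.

(** The proportion of the list assignments that are covering for all edges is a
product of factors [1 - z e ^+ k <= expR (- z e ^+ k)], and the [z e] have average
at least [a]. *)
Lemma prod_covering_lists (Ct : 'I_P -> {set V}) (theta a : R) :
  (forall i, #|Ct i|%:R <= theta * #|V0|%:R) ->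
  a = 1 - theta - k%:R / P%:R -> 0 <= a ->
  (\prod_(e in V0) #|covering_lists Ct e|)%N%:R <=
    ('C(P, k) ^ #|V0|)%N%:R * expR (- (#|V0|%:R * a ^+ k)).
Proof.
move=> leC aE a0.
have P0 : 0 < P%:R :> R by rewrite ltr0n.
pose z e : R := (P - #|colours_at Ct e| - k)%N%:R / P%:R.
have z0 e : 0 <= z e by rewrite divr_ge0.
have z_ge e : 1 - k%:R / P%:R - #|colours_at Ct e|%:R / P%:R <= z e.
  rewrite -(ler_pM2r P0) /z divfK ?gt_eqF // !mulrBl !divfK ?gt_eqF // mul1r.
  have : (P <= (#|colours_at Ct e| + k) + (P - #|colours_at Ct e| - k))%N.
    by rewrite -leq_subLR subnDA.
  rewrite -(ler_nat R) !natrD; lra.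
have sumz : #|V0|%:R * a ^+ k <= \sum_(e in V0) z e ^+ k.
  apply: sum_expr_ge => //.
  apply: le_trans (ler_sum _ (fun e _ => z_ge e)).
  rewrite sumrB sumr_const -mulr_suml -mulr_natl aE.
  have := sum_colours_at leC; rewrite -ler_pdivrMl // mulrC; lra.
apply: (@le_trans _ _ (('C(P, k) ^ #|V0|)%N%:R * expR (- \sum_(e in V0) z e ^+ k))); last first.
  by rewrite ler_wpM2l // ler_expR lerN2.
rewrite -sumrN expR_sum natrX -prodr_const -big_split natr_prod /=.
apply: ler_prod => e _; rewrite ler0n /= card_covering_lists.
rewrite natrB; last by rewrite leq_bin2l // leq_subr.
apply: (@le_trans _ _ ('C(P, k)%:R * (1 - z e ^+ k))); last first.
  by rewrite ler_wpM2l // expR_ge1Dx.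
rewrite mulrBr mulr1 lerD2l lerN2 /z exprMn exprVn mulrA ler_pdivrMr ?exprn_gt0 //.
by rewrite -!natrX -!natrM ler_nat bin_sub_ge.
Qed.

(** First moment method over all the [P]-tuples of members of [Cs]. *)
Theorem exists_uncovered_lists (Cs : seq {set V}) (theta a : R) :
  (forall C, C \in Cs -> #|C|%:R <= theta * #|V0|%:R) ->
  a = 1 - theta - k%:R / P%:R -> 0 <= a ->
  (size Cs)%:R ^+ P < expR (#|V0|%:R * a ^+ k) ->
  exists2 L : {ffun V -> {set 'I_P}}, (forall e, e \in V0 -> #|L e| = k) &
    forall Ct : 'I_P -> {set V}, (forall i, Ct i \in Cs) ->
      exists2 e, e \in V0 & forall i, i \in L e -> e \notin Ct i.
Proof.
move=> leC aE a0 few.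
pose klists (e : V) := [set A : {set 'I_P} | #|A| == k].
pose Lists := [set L : {ffun V -> {set 'I_P}} |
  [forall e, L e \in if e \in V0 then klists e else [set set0]]].
pose Ct (t : {ffun 'I_P -> 'I_(size Cs)}) i := nth set0 Cs (t i).
pose Bad t := [set L : {ffun V -> {set 'I_P}} |
  [forall e, L e \in if e \in V0 then covering_lists (Ct t) e else [set set0]]].
have CtCs t i : Ct t i \in Cs by rewrite mem_nth.
have cardLists : #|Lists| = ('C(P, k) ^ #|V0|)%N.
  rewrite card_family_on (eq_bigr (fun=> 'C(P, k))) ?prod_nat_const // => e _.
  by rewrite card_draws card_ord.
have bad_le t : #|Bad t|%:R <=
    ('C(P, k) ^ #|V0|)%N%:R * expR (- (#|V0|%:R * a ^+ k)) :> R.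
  rewrite card_family_on; apply: prod_covering_lists aE a0 => i.
  exact: leC.
have lt_bad : (\sum_t #|Bad t| < #|Lists|)%N.
  rewrite -(ltr_nat R) natr_sum.
  apply: (@le_lt_trans _ _ ((size Cs)%:R ^+ P * (#|Lists|%:R * expR (- (#|V0|%:R * a ^+ k))))).
    apply: le_trans (ler_sum _ (fun t _ => bad_le t)) _.
    rewrite sumr_const card_ffun !card_ord cardLists -[leLHS]mulr_natl.
    by rewrite (natrX _ (size Cs)).
  rewrite mulrCA -[ltRHS]mulr1 ltr_pM2l; last first.
    by rewrite cardLists ltr0n expn_gt0 bin_gt0 k_leP.
  by rewrite expRN -ltr_pdivlMr ?invr_gt0 ?expR_gt0 // invrK mul1r.
have : ~~ (Lists \subset \bigcup_t Bad t).
  apply/negP => /subset_leq_card; rewrite leqNgt => /negP; apply.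
  apply: leq_ltn_trans lt_bad.
  elim/big_rec2: _ => [|t m B _ leB]; first by rewrite cards0.
  have [le1 _] := leq_card_setU (Bad t) B; apply: leq_trans le1 _.
  by rewrite leq_add2l.
case/subsetPn => L LL noBad; exists L.
  move=> e eV; move: LL; rewrite inE => /forallP/(_ e).
  by rewrite eV inE => /eqP.
move=> C CCs.
suff /exists_inP[e eV /subsetP uncovered] :
    [exists e in V0, L e \subset ~: colours_at C e].
  by exists e => // i /uncovered; rewrite !inE.
apply: contraR noBad; rewrite negb_exists_in => /forall_inP allcov.
have ltC i : (index (C i) Cs < size Cs)%N by rewrite index_mem.
apply/bigcupP; exists [ffun i => Ordinal (ltC i)] => //.
rewrite inE; apply/forallP => e; move: LL; rewrite inE => /forallP/(_ e).
case: ifP => // eV; rewrite !inE => ->.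
apply: contra (allcov e eV) => /subsetP sub; apply/subsetP => i /sub.
by rewrite !inE /Ct ffunE /= nth_index.
Qed.

End RandomLists.

(** Without monochromatic copy each colour class lies in a container, so the edge given
by [exists_uncovered_lists] for these containers has no colour. *)
Theorem list_ramsey_of_containers (R : realType) (l : nat) (T : finType)
    (H : {set {set T}}) (n k P M : nat) (theta a : R) :
  (0 < P)%N -> (k <= P)%N ->
  covered (@sparse R l n theta) M
    (fun I => ~~ contains_copy H I /\ I \subset complete_hypergraph l n) ->
  a = 1 - theta - k%:R / P%:R -> 0 <= a ->
  M%:R ^+ P < expR ('C(n, l)%:R * a ^+ k) ->
  list_ramsey_property l H k n.
Proof.
move=> P0 kP [Cs szCs [/allP smallCs cover]] aE a0 few.
have V0E : #|complete_hypergraph l n| = 'C(n, l) by rewrite card_draws card_ord.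
have [||L Lk uncovered] := @exists_uncovered_lists R _ (complete_hypergraph l n) P k
  P0 kP Cs theta a _ aE a0 _.
- by move=> C /smallCs; rewrite V0E.
- rewrite V0E; apply: le_lt_trans few.
  by rewrite lerXn2r ?nnegrE // ler_nat.
exists (fun e => [fset val i | i in L e]%fset); split.
  move=> e eV; rewrite -(Lk e eV) card_imfset /=; last exact: val_inj.
  by rewrite -cardE.
move=> c cL; pose class (i : nat) := [set e in complete_hypergraph l n | c e == i].
apply: contrapT => nomono.
have free i : ~~ contains_copy H (class i) by apply/negP => cc; apply: nomono; exists i.
have container_of (i : 'I_P) : exists C, C \in Cs /\ class i \subset C.
  have [|C CCs sub] := cover (class i); last by exists C.
  by split=> //; apply/subsetP => e; rewrite inE => /andP[].
have [Ct CtP] := choice container_of.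
have [i|e eV noCt] := uncovered Ct; first by case: (CtP i).
have /imfsetP[i /= iL ci] := cL e eV.
have := noCt i iL; rewrite (subsetP (CtP i).2) //.
by rewrite !inE ci eqxx andbT; move: eV; rewrite inE.
Qed.

(** * The choice of the number of vertices *)

Section Asymptotics.
Variables (R : realType) (l : nat) (T : finType) (H : {set {set T}}).
Hypotheses (H_uniform : uniform_hypergraph l H) (H_edges : (2 <= #|H|)%N).

(** Two edges span at most [2 * l] vertices. *)
Lemma max_density_ge : 1 <= max_density R l H * l%:R.
Proof.
case/card_gt1P: H_edges => e [d [eH dH ed]].
pose D := [set e; d].
have D2 : #|D| = 2 by rewrite cards2 ed.
have DH : D \subset H by apply/subsetP => x /set2P[] ->.
have DU x : x \in D -> x \subset e :|: d.
  by case/set2P=> ->; [apply: subsetUl|apply: subsetUr].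
have [|lU] := @density_bound R l T H H_uniform (e :|: d) D DH DU; first by rewrite D2.
rewrite D2 => /le_trans; apply.
rewrite ler_wpM2l ?bigmax_ge_id // ler_nat leq_subLR.
have [le1 _] := leq_card_setU e d; apply: leq_trans le1 _.
by rewrite (eqP (forall_inP H_uniform e eH)) (eqP (forall_inP H_uniform d dH)).
Qed.

Lemma max_density_gt0 : 0 < max_density R l H.
Proof.
rewrite lt_def bigmax_ge_id andbT; apply/negP => /eqP m0.
by have := max_density_ge; rewrite m0 mul0r ler10.
Qed.

(** With [a] slightly larger than [b = 1 - p - eps] and [sigma ^+ 4 = a / b], take
[y = (sigma ^+ 3 / a) ^+ k] and [n] just above the power [m] of [y]. The gap between
[n] and the claimed bound is a factor [sigma] to the power [k * m], and in the union
bound [y * a ^+ k = sigma ^+ (3 * k)] exceeds any multiple of [k ^+ 2] for large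
[k]. *)
Lemma list_ramsey_bound (eps : R) : 0 < eps -> eps < 1 - turan_density R l H ->
  exists A : R, forall k : nat, A <= k%:R ->
    exists2 n, list_ramsey_property l H k n &
      n%:R <= (1 - turan_density R l H - eps) `^ (- (k%:R * max_density R l H)).
Proof.
set p := turan_density R l H; set m := max_density R l H => eps0 eps_lt.
have m0 : 0 < m := max_density_gt0.
have p0 : 0 <= p := turan_density_ge0 R l H.
have d0 : 0 < eps / 4 by rewrite divr_gt0.
have [g [n0 cont]] := free_hypergraph_containers H_uniform d0 (ltnW H_edges).
pose c1 := (Num.trunc (4 / eps)).+1.
have c1d : c1%:R^-1 <= eps / 4.
  rewrite -[leRHS]invrK lef_pV2 ?posrE ?invr_gt0 // invf_div ltW // truncnS_gt //.
pose a := 1 - (p + eps / 4) - c1%:R^-1; pose b := 1 - p - eps.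
have b0 : 0 < b by rewrite /b; lra.
have ba : b < a by rewrite /a /b; lra.
have a0 : 0 < a by lra.
have a1 : a <= 1.
  have : 0 <= c1%:R^-1 :> R by rewrite invr_ge0.
  rewrite /a; lra.
(* Three factors sigma are spent on the union bound and one on the factor 2 in nZ. *)
pose sigma := (a / b) `^ 4^-1.
have sigma4 : sigma ^+ 4 = a / b.
  by rewrite -powR_mulrn ?powR_ge0 // -powRrM mulVf // powRr1 // divr_ge0 // ltW.
have sigma1 : 1 < sigma.
  rewrite ltNge; apply/negP => sigma_le.
  have : sigma ^+ 4 <= 1 by rewrite exprn_ile1 ?powR_ge0.
  by rewrite sigma4 ler_pdivrMr // mul1r leNgt ba.
have sigma0 : 0 < sigma := lt_trans ltr01 sigma1.
pose Y := sigma ^+ 3 / a.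
have Y1 : 1 <= Y.
  rewrite ler_pdivlMr // mul1r (le_trans a1) // exprn_ege1 // ltW //.
have Y0 : 0 < Y := lt_le_trans ltr01 Y1.
pose Z := Y `^ m; pose tau := sigma `^ m.
have tau1 : 1 < tau.
  have one : 1 `^ m = 1 :> R by rewrite powR1.
  by rewrite -one; apply: gt0_ltr_powR; rewrite ?nnegrE ?ltW.
have Z_ge_tau : tau <= Z.
  apply: ge0_ler_powR; rewrite ?nnegrE ?(ltW m0) ?(ltW sigma0) ?(ltW Y0) //.
  rewrite ler_pdivlMr // exprS; apply: ler_wpM2l; first exact: ltW.
  by apply: le_trans a1 _; rewrite exprn_ege1 // ltW.
have Z1 : 1 < Z := lt_le_trans tau1 Z_ge_tau.
have Z0 : 0 < Z := lt_trans ltr01 Z1.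
pose W := 2 ^+ l.+1 * Z ^+ l.
have W1 : 1 <= W.
  by rewrite -[1]mulr1 ler_pM // exprn_ege1 // ?ltW // ?ltr1n // ltW.
pose cl : R := (2 ^ l * l`!)%N%:R.
pose C3 := g%:R * c1%:R * ln W * (1 + cl).
have C30 : 0 <= C3.
  by rewrite !mulr_ge0 // ?ln_ge0 // addr_ge0.
pose s := sigma - 1.
have s0 : 0 < s by rewrite subr_gt0.
pose N1 := (maxn n0 (2 * l)).+2.
exists (2 + C3 / s ^+ 3 + N1%:R / (tau - 1)) => k kA.
have t10 : 0 < tau - 1 by rewrite subr_gt0.
have q1 : 0 <= C3 / s ^+ 3 by rewrite divr_ge0 ?exprn_ge0 // ltW.
have q2 : 0 <= N1%:R / (tau - 1) by rewrite divr_ge0 // ltW.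
have [kR0 kC3 kN1] : [/\ 0 < k%:R :> R, C3 / s ^+ 3 < k%:R & N1%:R / (tau - 1) <= k%:R].
  move: (C3 / _) (N1%:R / _) (k%:R : R) q1 q2 kA => u v z; clear => u0 v0 zA.
  by split; lra.
have k0 : (0 < k)%N by rewrite -(ltr_nat R).
pose y := Y ^+ k.
have y1 : 1 <= y by rewrite exprn_ege1.
have y0 : 0 < y := lt_le_trans ltr01 y1.
have yZ : y `^ m = Z ^+ k.
  by rewrite -[Z ^+ k]powR_mulrn ?powR_ge0 // -powRrM mulrC powRrM powR_mulrn // ltW.
have tauk : N1%:R <= tau ^+ k.
  apply: le_trans (bernoulli_ge k (ltW tau1)).
  apply: le_trans (_ : k%:R * (tau - 1) <= _); last by rewrite lerDr.
  by rewrite -ler_pdivrMr.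
have Zk : N1%:R <= Z ^+ k.
  by apply: le_trans tauk _; rewrite lerXn2r ?nnegrE ?powR_ge0.
pose n := (Num.trunc (Z ^+ k)).+1.
have Zk0 : 0 <= Z ^+ k by rewrite exprn_ge0 // ltW.
have Zn : Z ^+ k <= n%:R by rewrite ltW // truncnS_gt.
have N1n : (N1 <= n)%N by rewrite -(ler_nat R) (le_trans Zk).
have Zk1 : 1 <= Z ^+ k by rewrite exprn_ege1 // ltW.
have nZ : n%:R <= 2 * Z ^+ k.
  have /andP[le1 _] := truncn_itv Zk0.
  by rewrite -[n%:R]natr1 mulr_natl mulr2n lerD.
have n0n : (n0 <= n)%N.
  by apply: leq_trans N1n; do 2 apply: leqW; apply: leq_maxl.
have l2n : (2 * l <= n)%N.
  by apply: leq_trans N1n; do 2 apply: leqW; apply: leq_maxr.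
have ln_ : (l <= n)%N by apply: leq_trans l2n; rewrite leq_pmull.
pose N := 'C(n, l).
have N0 : (0 < N)%N by rewrite bin_gt0.
have NR0 : 0 < N%:R :> R by rewrite ltr0n.
pose F := (Num.trunc (N%:R / y)).+1.
have NF : N%:R <= F%:R * y.
  by rewrite -ler_pdivrMr // ltW // truncnS_gt.
have y_le : y <= cl * N%:R.
  have nl : n%:R ^+ l <= cl * N%:R by rewrite -natrX -natrM ler_nat leq_expn_bin.
  have := ler_powR y1 max_density_ge.
  rewrite (powRr1 (ltW y0)) powRrM -/m yZ powR_mulrn // => y_le.
  by apply: le_trans y_le (le_trans _ nl); rewrite lerXn2r ?nnegrE.
have F_le : F%:R <= (1 + cl) * (N%:R / y).
  rewrite -natr1 mulrDl mul1r lerD //.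
    by have /andP[] := truncn_itv (divr_ge0 (ler0n R N) (ltW y0)).
  by rewrite mulrA ler_pdivlMr // mul1r.
have NW : N.+1%:R <= W ^+ k.
  apply: (@le_trans _ _ (2 * n%:R ^+ l)).
    rewrite -natrX -natrM ler_nat mul2n -addnn -addn1 addnC.
    by rewrite leq_add ?expn_gt0 ?leq_bin_expn // (leq_trans _ l2n) // (leq_trans _ N1n).
  apply: (@le_trans _ _ (2 ^+ l.+1 * (Z ^+ k) ^+ l)).
    rewrite exprS -mulrA ler_wpM2l // -exprMn lerXn2r ?nnegrE ?mulr_ge0 //.
  rewrite /W exprMn -!exprM mulnC ler_wpM2r ?exprn_ge0 ?(ltW Z0) //.
  by rewrite ler_weXn2l ?ler1n // leq_pmulr.
exists n.
  apply: (list_ramsey_of_containers (P := (c1 * k)%N) _ _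
     (cont n y F n0n y1 _ NF) (a := a) _ (ltW a0) _).
  - by rewrite muln_gt0 k0.
  - by rewrite leq_pmull.
  - by rewrite -/m yZ.
  - by rewrite /a natrM invfM mulrCA mulfV ?gt_eqF // mulr1.
  rewrite -/N natrX -exprM.
  apply: le_lt_trans (_ : (W ^+ k) ^+ (g * F * (c1 * k)) < _).
    by rewrite lerXn2r ?nnegrE ?exprn_ge0 // (le_trans ler01).
  have WE : W = expR (ln W) by rewrite lnK // posrE (lt_le_trans ltr01).
  rewrite WE -!expRM_natl ltr_expR.
  have sk : k%:R * s <= sigma ^+ k.
    by apply: le_trans (bernoulli_ge k (ltW sigma1)); rewrite lerDr.
  have cubic : C3 * k%:R ^+ 2 < (sigma ^+ k) ^+ 3.
    apply: (@lt_le_trans _ _ ((k%:R * s) ^+ 3)); last first.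
      by rewrite lerXn2r ?nnegrE ?mulr_ge0 ?exprn_ge0 // ltW.
    rewrite exprMn [k%:R ^+ 3]exprSr -mulrA mulrC ltr_pM2l ?exprn_gt0 //.
    by rewrite -ltr_pdivrMr ?exprn_gt0.
  have Ny : N%:R * a ^+ k = (sigma ^+ k) ^+ 3 * (N%:R / y).
    rewrite /y /Y exprMn exprVn -!exprM [(3 * k)%N]mulnC.
    by field; rewrite !gt_eqF ?exprn_gt0.
  rewrite Ny; apply: (@le_lt_trans _ _ (C3 * k%:R ^+ 2 * (N%:R / y))); last first.
    by rewrite ltr_pM2r // divr_gt0.
  have := ler_wpM2l (_ : 0 <= g%:R * c1%:R * ln W * k%:R ^+ 2) F_le.
  rewrite !mulr_ge0 ?ln_ge0 ?exprn_ge0 // => /(_ isT).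
  by rewrite !natrM /C3; congr (_ <= _); ring.
have bE : b^-1 = sigma * Y.
  rewrite /Y mulrA -exprS sigma4; field; rewrite !gt_eqF //.
rewrite -/b -mulN1r powRrM powR_inv1 ?(ltW b0) // mulrC powRrM.
rewrite powR_mulrn ?powR_ge0 // bE powRM ?(ltW sigma0) ?(ltW Y0) // exprMn.
apply: le_trans nZ _; rewrite ler_wpM2r //; apply: le_trans tauk.
by rewrite ler_nat.
Qed.

End Asymptotics.

(** * The error term *)

(** The minimum defining the Ramsey number is attained as soon as some [n] has the
Ramsey property. *)
Lemma list_ramsey_number_le (l : nat) (T : finType) (H : {set {set T}}) (k n : nat) :
  list_ramsey_property l H k n ->
  exists2 n', is_list_ramsey_number l H k n' & (n' <= n)%N.
Proof.
move=> propn; have ex : exists n', `[< list_ramsey_property l H k n' >].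
  by exists n; apply/asboolP.
case: (ex_minnP ex) => n' /asboolP propn' min_n'; exists n'.
  by split=> // j /asboolP; apply: min_n'.
exact/min_n'/asboolP.
Qed.

Local Open Scope classical_set_scope.
Local Open Scope ring_scope.

Theorem theorem5 (R : realType) (l : nat) (T : finType) (H : {set {set T}})
    (H_uniform : uniform_hypergraph l H) (H_edges : (2 <= #|H|)%N) :
  exists o : nat -> R,
    o k @[k --> \oo] --> (0 : R) /\
    \forall k \near \oo,
      exists2 n : nat, is_list_ramsey_number l H k n &
        n%:R <= (1 - turan_density R l H + o k)
                  `^ (- (k%:R * max_density R l H)).
Proof.
set p := turan_density R l H; set m := max_density R l H.
have m0 : 0 < m := max_density_gt0 R H_uniform H_edges.
have p0 : 0 <= p := turan_density_ge0 R l H.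
have p1 : p < 1 := turan_density_lt1 R H_uniform (ltnW H_edges).
have /choice[nk nkP] : forall k, exists nk,
    (exists n, list_ramsey_property l H k n) -> is_list_ramsey_number l H k nk.
  move=> k; have [[n /list_ramsey_number_le[n' numn' _]]|none] :=
    pselect (exists n, list_ramsey_property l H k n); first by exists n'.
  by exists 0%N => ex; case: none.
(* root k is the base for which the claimed bound is an equality. The maximum with 1
   keeps it positive. An upper bound on the Ramsey number is a lower bound on root, so
   the error term can be cut off at 0 from above. *)
pose root k : R := (maxn 1 (nk k))%:R `^ (- (k%:R * m)^-1).
pose o k : R := Num.min 0 (root k - (1 - p)).
have root_ge eps : 0 < eps -> eps < 1 - p ->
    \forall k \near \oo, 1 - p - eps <= root k /\ (0 < k)%N /\
      is_list_ramsey_number l H k (nk k).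
  move=> eps0 eps_lt.
  have [A bound] := list_ramsey_bound H_uniform H_edges eps0 eps_lt.
  near=> k.
  have k0 : (0 < k)%N by near: k; apply: nbhs_infty_gt.
  have [|n propn n_le] := bound k.
    by near: k; apply: nbhs_infty_ger; rewrite num_real.
  have numk : is_list_ramsey_number l H k (nk k) by apply: nkP; exists n.
  split=> //; rewrite -/p -/m in n_le.
  have km0 : 0 < k%:R * m by rewrite mulr_gt0 // ltr0n.
  set b := 1 - p - eps in n_le *.
  have b0 : 0 < b by rewrite /b; lra.
  have pw0 : 0 < b `^ (- (k%:R * m)) by rewrite powR_gt0.
  have max_le : (maxn 1 (nk k))%:R <= b `^ (- (k%:R * m)).
    rewrite /maxn; case: ifP => _.
      by apply: le_trans n_le; rewrite ler_nat; apply: numk.2.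
    rewrite powRN invf_ge1 ?powR_gt0 // -[leRHS](powRr0 b).
    have b01 : 0 < b <= 1 by rewrite b0 /b /=; lra.
    exact: ger_powR b01 _ _ (ltW km0).
  have : (maxn 1 (nk k))%:R `^ (k%:R * m)^-1 <= b^-1.
    have <- : (b `^ (- (k%:R * m))) `^ (k%:R * m)^-1 = b^-1.
      by rewrite -powRrM mulNr mulfV ?gt_eqF // powR_inv1 ?ltW.
    by apply: ge0_ler_powR; rewrite ?nnegrE ?invr_ge0 ?(ltW km0) ?(ltW pw0).
  rewrite /root powRN => rb; rewrite -[leLHS]invrK lef_pV2 // posrE ?invr_gt0 //.
exists o; split.
  apply/cvgrPdist_le => eps eps0.
  pose d := Num.min eps ((1 - p) / 2).
  have d0 : 0 < d by rewrite lt_min eps0 divr_gt0 // subr_gt0.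
  have d_lt : d < 1 - p by rewrite gt_min; apply/orP; right; lra.
  have d_le : d <= eps by rewrite ge_min lexx.
  apply: filterS (root_ge d d0 d_lt) => k [rk _].
  have o0 : o k <= 0 by rewrite ge_min lexx.
  rewrite sub0r normrN ler0_norm //.
  suff : - d <= o k by lra.
  by rewrite le_min; apply/andP; split; lra.
have h0 : 0 < (1 - p) / 2 by rewrite divr_gt0 // subr_gt0.
have h1 : (1 - p) / 2 < 1 - p by lra.
apply: filterS (root_ge _ h0 h1) => k [_ [k0 numk]]; exists (nk k) => //.
have km0 : 0 < k%:R * m by rewrite mulr_gt0 // ltr0n.
have n1 : (0 < maxn 1 (nk k))%N by rewrite leq_max.
have root0 : 0 < root k by rewrite powR_gt0 // ltr0n.
have base0 : 0 < 1 - p + o k.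
  by rewrite /o; case: (leP 0) => _; lra.
have base_le : 1 - p + o k <= root k.
  have : o k <= root k - (1 - p) by rewrite ge_min lexx orbT.
  lra.
apply: (@le_trans _ _ (maxn 1 (nk k))%:R); first by rewrite ler_nat leq_maxr.
have -> : (maxn 1 (nk k))%:R = root k `^ (- (k%:R * m)) :> R.
  by rewrite /root -powRrM mulrNN mulVf ?gt_eqF // powRr1.
rewrite !powRN lef_pV2 ?posrE ?powR_gt0 //.
by apply: ge0_ler_powR; rewrite ?nnegrE ?(ltW km0) ?(ltW base0) ?(ltW root0).
Unshelve. all: by end_near.
Qed.
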